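(* Let $n\ge 2$ and let $\mathbb H^n_{\mathbb C}$ be the complex hyperbolic space of complex dimension $n$, with its hyperbolic distance $\mathrm{dist}$. (1) The metric space $(\mathbb H^n_{\mathbb C},\mathrm{dist})$ cannot be isometrically embedded into a median space. In particular, $\mathrm{dist}$ is not a wall metric. (2) For any $\alpha\in[1/2,1)$, whenever $\mathrm{dist}^\alpha$ is a wall metric, $(\mathbb H^n_{\mathbb C},\mathrm{dist}^\alpha)$ cannot be at bounded Hausdorff distance from a median space; that is, there is no isometric embedding of $(\mathbb H^n_{\mathbb C},\mathrm{dist}^\alpha)$ into a median space $\mathcal M$ such that $\mathcal M$ is within bounded Hausdorff distance from the image.
   Context: A median space is a metric space $(\mathcal M,d)$ such that for every triple of points $x_1,x_2,x_3$ there is a unique point $m$ with $d(x_i,m)+d(m,x_j)=d(x_i,x_j)$ for all $i\ne j$. A wall of a set $X$ is a partition $\{h,h^c\}$ of $X$ ($h$ may be empty or all of $X$). A space with measured walls is a set $X$ with a collection $\mathcal W$ of walls, a $\sigma$-algebra $\mathcal B$ on $\mathcal W$, and a measure $\mu$ on $\mathcal B$ such that for all $x,y\in X$ the set $\mathcal W(x|y)$ of walls having $x$ and $y$ in different parts belongs to $\mathcal B$ and has finite measure. A metric $d$ on $X$ is a wall metric if there is such a structure on $X$ with $d(x,y)=\mu(\mathcal W(x|y))$ for all $x,y$. *)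

(* Defs.v *)
From HB Require Import structures.
From mathcomp Require Import all_boot all_order all_algebra.
From mathcomp Require Import all_classical all_reals all_analysis.
From mathcomp Require Import complex.

Set Implicit Arguments.
Unset Strict Implicit.
Unset Printing Implicit Defensive.

Import Order.TTheory GRing.Theory Num.Theory.
Import numFieldNormedType.Exports.

Local Open Scope classical_set_scope.
Local Open Scope ring_scope.

Definition arcosh (R : realType) (x : R) : R := ln (x + Num.sqrt (x ^+ 2 - 1)).

(* Complex hyperbolic n-space is the set of negative lines for the Hermitian
   form x_1 y_1^* + ... + x_n y_n^* - x_{n+1} y_{n+1}^* on C^{n+1}.  A vector
   with x_{n+1} = 0 is not negative, so each such line contains exactly one
   vector of the form (z, 1); lines are represented by this z, which ranges
   over the open unit ball of C^n. *)
Definition herm (R : realType) (n : nat) (z w : 'rV[R[i]]_n) : R[i] :=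
  (\sum_(k < n) z ord0 k * (w ord0 k)^*) - 1.

Definition chyp (R : realType) (n : nat) : Type :=
  {z : 'rV[R[i]]_n | herm z z < 0}.

(* cosh (dist x y) = |<x, y>| / sqrt (<x, x> <y, y>), which does not depend on
   the vectors representing the two lines.  The sectional curvatures lie in
   [-4, -1]; other normalizations of the metric rescale chyp_dist by a constant. *)
Definition chyp_dist (R : realType) (n : nat) (x y : chyp R n) : R :=
  arcosh (complex.Re `|herm (val x) (val y)| /
          Num.sqrt (complex.Re (herm (val x) (val x) * herm (val y) (val y)))).

Definition median_space (R : realType) (M : metricType R) : Prop :=
  forall x1 x2 x3 : M, exists! m : M,
    [/\ mdist x1 m + mdist m x2 = mdist x1 x2,
        mdist x2 m + mdist m x3 = mdist x2 x3 &
        mdist x1 m + mdist m x3 = mdist x1 x3].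

Definition isometric_embedding (R : realType) (X : Type) (d : X -> X -> R)
    (M : metricType R) (f : X -> M) : Prop :=
  forall x y : X, mdist (f x) (f y) = d x y.

Definition bounded_hausdorff (R : realType) (M : metricType R) (A B : set M) :
    Prop :=
  exists C : R, (forall a, A a -> exists2 b, B b & mdist a b <= C) /\
                (forall b, B b -> exists2 a, A a & mdist b a <= C).

Definition is_wall (X : Type) (w : set (set X)) : Prop :=
  exists h : set X, w = [set h; ~` h].

Definition separates (X : Type) (w : set (set X)) (x y : X) : Prop :=
  exists2 h : set X, w h & h x /\ ~ h y.

(* The collection of walls is the image of the injection mw_wall.  A
   measurableType is nonempty; this is harmless, since an empty collection can
   be replaced by the one consisting of the trivial wall {set0, setT}. *)
Record measured_walls (R : realType) (X : Type) := MeasuredWalls {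
  mw_disp : measure_display;
  mw_index : measurableType mw_disp;
  mw_wall : mw_index -> set (set X);
  mw_is_wall : forall w, is_wall (mw_wall w);
  mw_wall_inj : injective mw_wall;
  mw_measure : {measure set mw_index -> \bar R};
  mw_measurable : forall x y : X,
    measurable [set w | separates (mw_wall w) x y];
  mw_finite : forall x y : X,
    (mw_measure [set w | separates (mw_wall w) x y] < +oo)%E
}.

(* To be applied to metrics d only. *)
Definition wall_metric (R : realType) (X : Type) (d : X -> X -> R) : Prop :=
  exists S : measured_walls R X, forall x y : X,
    (d x y)%:E = mw_measure S [set w | separates (mw_wall w) x y].

(* Main.v *)
Require Import Defs.
From mathcomp Require Import all_boot all_order all_algebra.
From mathcomp Require Import all_classical all_reals all_analysis.
From mathcomp Require Import complex ring lra.
Import Order.TTheory GRing.Theory Num.Theory.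
Import numFieldNormedType.Exports.
Local Open Scope classical_set_scope.
Local Open Scope ring_scope.

Set Implicit Arguments.
Unset Strict Implicit.

(** Part (1) rests on a rigidity phenomenon: an isometric embedding of a space
  X into a median space M pulls every halfspace of M (a convex set with convex
  complement) back to a subset H of X such that H and its complement are both
  geodesically convex, and complex hyperbolic space of dimension at least two
  has no such H besides the empty set and the whole space.  Intuitively the
  boundary of H would be a totally geodesic real hypersurface, and there is
  none.

  The median side is [halfspace_separation], the Kakutani separation property:
  a maximal convex set avoiding a point has a convex complement.  It is combined
  with the fact that the convex hull of a finite set is bounded
  ([convex_bounded_hull]), so that in an unbounded X one can choose H to contain
  any prescribed finite set and still miss a point
  ([halfspace_through_finite]).  Everything is done for pseudo-metrics.  This
  brings wall metrics under the same roof: sending x to the set of walls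
  separating x from a base point embeds X in the measurable sets of finite
  measure with d(A, B) the measure of the symmetric difference, where the median
  of three sets is the majority set, unique up to null sets
  ([wall_metric_pseudo_median]).

  The hyperbolic side is [convex_cut_trivial], on the unit ball of C^2.  Choose
  H so that it contains eight points on the coordinate axes; then it contains a
  neighbourhood of 0 ([ball_in_hull]).  If the complement of H is nonempty, its
  closure has a point p nearest to 0, and p is not 0.  A geodesic that leaves p
  on the side of 0 enters the ball of radius |p|, which lies in H; reversing
  geodesics through p settles the opposite side.  Hence H and its complement are
  separated by the hypersurface swept out by the geodesics tangent at p to the
  sphere of radius |p|.  With h = <p, q> - 1 its equation in q is
  |h|^2 + (1 - |p|^2) Re h = 0 ([tangent_form_gt0], [tangent_form_lt0]).  Two
  explicit points on the side of H have a point of the geodesic between them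
  strictly on the other side, because of the imaginary part that the geodesic
  picks up in the direction of i p: a contradiction.

  Part (2) is coarser.  Take the center 0 and two opposite points at distance
  rho from it.  If their images had a median within C of the image of some p,
  then dist^alpha would be additive along p up to 2C for the three pairs.
  One of the two opposite points is at distance at least rho from p; applied to
  this point and 0, near-additivity bounds dist(0, p) independently of rho.  So
  p is at distance about rho from both opposite points, while their own distance
  is 2 rho, and 2 rho^alpha - (2 rho)^alpha tends to infinity since alpha < 1
  ([power_gap], [snowflake_not_near_median]). *)

(** * Halfspaces of median spaces *)

Section Median.
Context {R : realType} {T : Type}.
Variable d : T -> T -> R.

Definition between (a m b : T) : Prop := d a m + d m b = d a b.

Definition is_median (m x y z : T) : Prop :=
  [/\ between x m y, between y m z & between x m z].

(** Distances may vanish between distinct points, so that medians are unique only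
  up to distance 0: sets of finite measure with the measure of the symmetric
  difference are the example that matters besides median spaces. *)
Record pseudo_median : Prop := PseudoMedian {
  pm_refl : forall x, d x x = 0;
  pm_sym : forall x y, d x y = d y x;
  pm_triangle : forall x y z, d x z <= d x y + d y z;
  pm_median : forall x y z, exists m, is_median m x y z;
  pm_unique : forall x y z m m',
    is_median m x y z -> is_median m' x y z -> d m m' = 0
}.

Definition convex_for (A : set T) : Prop :=
  forall a b m, A a -> A b -> between a m b -> A m.

Hypothesis pm : pseudo_median.

Let dC := pm_sym pm.
Let dT := pm_triangle pm.
Let d0 := pm_refl pm.

Let d_ge0 a b : 0 <= d a b.
Proof. by have := dT a b a; have := d0 a; have := dC a b; lra. Qed.

Lemma betweenC a m b : between a m b -> between b m a.
Proof.
by rewrite /between; have := dC a m; have := dC m b; have := dC a b; lra.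
Qed.

Lemma between_trans a u v b :
  between a u b -> between a v u -> between a v b /\ between v u b.
Proof. by rewrite /between; have := dT a v b; have := dT v u b; lra. Qed.

Lemma between_transl a u v b :
  between a u b -> between a v u -> between a v b.
Proof. by move=> h1 h2; have [] := between_trans h1 h2. Qed.

Lemma between_transr a u v b :
  between a u b -> between a v u -> between v u b.
Proof. by move=> h1 h2; have [] := between_trans h1 h2. Qed.

Lemma between0 a m m' b : d m m' = 0 -> between a m b -> between a m' b.
Proof.
rewrite /between => h.
have := dT a m m'; have := dT m' m b; have := dT a m' b.
by have := dC m m'; lra.
Qed.

(** The medians of w with the four sides of the rectangle u, m1, v, m2 give two
  medians r and s of w, m1, m2, the first on every side leaving u, the second on
  every side leaving v.  By uniqueness r and s agree, and then the path from u
  to v through them is too short unless w is r. *)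
Lemma between_rectangle u v m1 m2 w :
    between u m1 v -> between u m2 v -> between m1 u m2 -> between m1 v m2 ->
  between u w v -> between m1 w m2.
Proof.
move=> um1v um2v m1um2 m1vm2 uwv.
have [p [wpu upm1 wpm1]] := pm_median pm w u m1.
have [q [wqv vqm1 wqm1]] := pm_median pm w v m1.
have [p' [wpu' upm2 wpm2]] := pm_median pm w u m2.
have [q' [wqv' vqm2 wqm2]] := pm_median pm w v m2.
have [r [wrp prp' wrp']] := pm_median pm w p p'.
have [s [wsq qsq' wsq']] := pm_median pm w q q'.
have hr : is_median r w m1 m2.
  split; [exact: between_transl wpm1 wrp| |exact: between_transl wpm2 wrp'].
  move: m1um2 prp' upm1 upm2; rewrite /between.
  have := dT p u p'; have := dT m1 p r; have := dT r p' m2; have := dT m1 r m2.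
  by have := dC m1 u; have := dC m1 p; have := dC p u; lra.
have hs : is_median s w m1 m2.
  split; [exact: between_transl wqm1 wsq| |exact: between_transl wqm2 wsq'].
  move: m1vm2 qsq' vqm1 vqm2; rewrite /between.
  have := dT q v q'; have := dT m1 q s; have := dT s q' m2; have := dT m1 s m2.
  by have := dC m1 v; have := dC m1 q; have := dC q v; lra.
have rs := pm_unique pm hr hs.
have wru := between_transl wpu wrp.
have wsv := between_transl wqv wsq.
have wr0 : d w r = 0.
  move: wru wsv uwv; rewrite /between.
  have := dT u r v; have := dT r s v; have := d_ge0 w r; have := d_ge0 w s.
  by have := dC u r; have := dC u w; lra.
by have [_ h _] := hr; apply: between0 h; rewrite dC.
Qed.

(** The medians m1 of a, u, v and m2 of b, u, v form with u and v a rectangle that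
  lies on a geodesic from a to b; this reduces to the case of a rectangle. *)
Lemma between_convex a b : convex_for [set m | between a m b].
Proof.
move=> u v w /= aub avb uwv.
have [m1 [am1u um1v am1v]] := pm_median pm a u v.
have [m2 [bm2u um2v bm2v]] := pm_median pm b u v.
have m12 : d m1 m2 = d u v /\ d a m1 + d m1 m2 + d m2 b = d a b.
  move: aub avb am1u um1v am1v bm2u um2v bm2v; rewrite /between.
  have := dT m1 u m2; have := dT m1 v m2.
  have := dT a m1 b; have := dT m1 m2 b.
  have := dC m1 u; have := dC m2 u; have := dC m1 v; have := dC m2 v.
  by have := dC u b; have := dC v b; have := dC m2 b; lra.
have : between m1 w m2.
  apply: (between_rectangle um1v um2v) => //.
    move: um1v um2v m12.1; rewrite /between.
    have := dT m1 v m2; have := dT m1 u m2.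
    by have := dC m1 u; have := dC m2 u; have := dC m1 v; have := dC m2 v; lra.
  move: um1v um2v m12.1; rewrite /between.
  have := dT m1 v m2; have := dT m1 u m2.
  by have := dC m1 u; have := dC m2 u; have := dC m1 v; have := dC m2 v; lra.
rewrite /between; have := dT a w b; have := dT a m1 w; have := dT w m2 b.
by case: m12; lra.
Qed.

(** So m is the gate of the interval from a to b seen from w.  The median of w, m
  and e lies between each two of a, b and w, hence agrees with m. *)
Lemma median_gate m a b w e :
  is_median m a b w -> between a e b -> between w m e.
Proof.
move=> [amb bmw amw] aeb.
have [f [wfm mfe wfe]] := pm_median pm w m e.
have hf : is_median f a b w.
  split; first exact: between_convex amb aeb mfe.
    exact: betweenC (between_transl (betweenC bmw) wfm).
  exact: betweenC (between_transl (betweenC amw) wfm).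
by apply: between0 wfe; apply: (pm_unique pm hf); split.
Qed.

(** A halfspace that contains w but not v contains neither a nor z, hence not x:
  this is why v lies between w and x.  The gates of w and v on the interval from
  a to z coincide, which makes the argument direct. *)
Lemma between_join w v a z x :
  between w v a -> between w v z -> between a x z -> between w v x.
Proof.
move=> wva wvz axz.
have [g hg] := pm_median pm a z w.
have [g' hg'] := pm_median pm a z v.
have wgx := median_gate hg axz.
have gg' : d g' g = 0.
  apply: (pm_unique pm _ hg).
  case: hg' => h1 h2 h3; split=> //.
    exact: between_transl (betweenC wvz) h2.
  exact: between_transl (betweenC wva) h3.
have agv : between a g v by apply: between0 gg' _; case: hg'.
apply: between_transl wgx _.
by apply: betweenC; apply: between_transr (betweenC wva) agv.
Qed.

Lemma between_self w v : between w v w -> d v w = 0.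
Proof. by rewrite /between; have := dC w v; have := d0 w; lra. Qed.

Definition join_point (A : set T) (z : T) : set T :=
  [set w | exists2 a, A a & between a w z].

(** Peano property.  For w between a point of the segment [a, z] and a point of
  [b, z], the point c of [a, b] such that w is between c and z is the gate of w
  on [a, b]. *)
Lemma join_convex A z : convex_for A -> convex_for (join_point A z).
Proof.
move=> cA x y w [a Aa axz] [b Ab byz] xwy.
have [c hc] := pm_median pm a b w; have [acb bcw acw] := hc.
exists c; first exact: cA Aa Ab acb.
have [v [cvw wvz cvz]] := pm_median pm c w z.
have wva := between_transl (betweenC acw) (betweenC cvw).
have wvb := between_transl (betweenC bcw) (betweenC cvw).
have wvx := between_join wva wvz axz.
have wvy := between_join wvb wvz byz.
by apply: between0 cvz; apply: between_self; apply: between_join wvx wvy xwy.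
Qed.

(** Adding one point z to a convex set amounts to joining it with z, and a join
  stays bounded. *)
Lemma convex_bounded_hull (o : T) (s : seq T) : exists A : set T,
  [/\ convex_for A, A o, forall x, List.In x s -> A x &
      exists D, forall x, A x -> d o x <= D].
Proof.
elim: s => [|z s [A [cA Ao sA [D AD]]]].
  exists [set m | between o m o]; split=> //=.
  - exact: between_convex.
  - by rewrite /between d0 addr0.
  - by exists 0 => x; rewrite dC => /between_self ->.
exists (join_point A z); split.
- exact: join_convex.
- by exists o => //; rewrite /between d0 add0r.
- move=> x [<-|xs]; first by exists o => //; rewrite /between d0 addr0.
  by exists x; [exact: sA | rewrite /between d0 add0r].
- exists (D + D + d o z) => x [a Aa axz].
  move: axz (AD _ Aa); rewrite /between.
  have := dT o a x; have := dT a o z; have := dC a o; have := d_ge0 x z; lra.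
Qed.

Definition halfspace (H : set T) : Prop := convex_for H /\ convex_for (~` H).

(** Let H be maximal among the convex sets that contain A and avoid y.  If p and q
  are outside H, then by maximality y lies on segments [a, p] and [a', q] with a
  and a' in H.  A point r of H on [p, q] would put y in the convex hull of a, a'
  and r, hence in H. *)
Lemma halfspace_separation (A : set T) (o y : T) :
    convex_for A -> A o -> ~ A y ->
  exists H, [/\ halfspace H, A `<=` H & ~ H y].
Proof.
move=> cA Ao Ay.
pose P (B : set T) := B = set0 \/ [/\ convex_for B, A `<=` B & ~ B y].
(* The empty set is admitted in P to have an upper bound of the empty chain. *)
have [F FP tF|H [PH maxH]] := @Zorn_bigcup T P.
  have [F0|] := pselect (forall B, F B -> B = set0).
    by left; rewrite bigcup0.
  move=> /existsNP[B0 /not_implyP[FB0 /eqP/set0P[b B0b]]].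
  have FP' B : F B -> B !=set0 -> [/\ convex_for B, A `<=` B & ~ B y].
    by move=> FB [x Bx]; have [B0'|//] := FP _ FB; rewrite B0' in Bx.
  right; split.
  - move=> x x' m [B1 FB1 B1x] [B2 FB2 B2x'] xmx'.
    have [B12|B21] := tF _ _ FB1 FB2.
      have [cB _ _] := FP' _ FB2 (ex_intro _ _ B2x').
      by exists B2 => //; apply: cB xmx' => //; apply: B12.
    have [cB _ _] := FP' _ FB1 (ex_intro _ _ B1x).
    by exists B1 => //; apply: cB xmx' => //; apply: B21.
  - move=> x Ax; exists B0 => //.
    by have [_ AB _] := FP' _ FB0 (ex_intro _ _ B0b); apply: AB.
  - by move=> [B FB By]; have [_ _] := FP' _ FB (ex_intro _ _ By).
have H0 : H <> set0.
  move=> H0; apply: (maxH A); last by right; split.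
  by rewrite H0; split=> // /(_ _ Ao).
case: PH => // -[cH AH Hy].
exists H; split=> //; split=> // p q r /= nHp nHq prq Hr.
have reach z : ~ H z -> exists2 a, H a & between a y z.
  move=> nHz; apply: contrapT => nex.
  apply: (maxH (join_point H z)).
    split; first by move=> x Hx; exists x => //; rewrite /between d0 add0r.
    move=> /(_ z) h; apply: nHz; apply: h.
    by exists o; [exact: AH|rewrite /between d0 addr0].
  right; split=> //; first exact: join_convex.
  by move=> x Ax; exists x; [exact: AH|rewrite /between d0 add0r].
have [a Ha ayp] := reach _ nHp.
have [a' Ha' ayq] := reach _ nHq.
(* The point of the hull of a, a' and r that has to coincide with y. *)
have [c [aca' a'cy acy]] := pm_median pm a a' y.
have [e [cer rey cey]] := pm_median pm c r y.
have Hc : H c by apply: cH aca'.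
have He : H e by apply: cH cer.
have yea := between_transl (betweenC acy) (betweenC cey).
have yea' := between_transl (betweenC a'cy) (betweenC cey).
have eyp := between_transr ayp (betweenC yea).
have eyq := between_transr ayq (betweenC yea').
have eyr := between_join eyp eyq prq.
apply: Hy; apply: (cH e e) => //.
have ey0 : d e y = 0.
  by move: eyr rey; rewrite /between; have := dC e y; have := dC r e;
    have := dC r y; lra.
by apply: between0 ey0 _; rewrite /between d0 addr0.
Qed.

End Median.

(** Unboundedness supplies a point outside the bounded convex hull of the finite
  set; the halfspace that separates the two is pulled back along f. *)
Lemma halfspace_through_finite (R : realType) (T X : Type) (d : T -> T -> R)
    (dX : X -> X -> R) (f : X -> T) (s : seq X) (o : X) (Y : set X) :
    pseudo_median d -> (forall x y, d (f x) (f y) = dX x y) ->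
    (forall D, exists2 y, Y y & D < dX o y) ->
  exists H : set X, [/\ halfspace dX H,
    forall x, List.In x s -> H x & exists2 y, Y y & ~ H y].
Proof.
move=> pm isof unbounded.
have [A [cA Ao As [D AD]]] := convex_bounded_hull pm (f o) (map f s).
have [y Yy Dy] := unbounded D.
have Ay : ~ A (f y) by move=> /AD; rewrite isof leNgt Dy.
have [H [[cH cHC] AH Hy]] := halfspace_separation pm cA Ao Ay.
have pull (B : set T) : convex_for d B -> convex_for dX (f @^-1` B).
  by move=> cB a b m /= Ba Bb amb; apply: cB Ba Bb _; rewrite /between !isof.
exists (f @^-1` H); split; [split|by move=> x xs; apply/AH/As/List.in_map|].
- exact: pull.
- exact: pull cHC.
- by exists y.
Qed.

Lemma median_space_pseudo_median (R : realType) (M : metricType R) :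
  median_space M -> pseudo_median (@mdist R M).
Proof.
move=> med; split.
- exact: mdistxx.
- exact: metric_sym.
- exact: metric_triangle.
- by move=> x y z; have [m [hm _]] := med x y z; exists m.
- move=> x y z m m' hm hm'; have [m0 [_ um]] := med x y z.
  by rewrite -(um m hm) -(um m' hm') mdistxx.
Qed.

(** * Wall metrics *)

Section FiniteMeasureSets.
Context {R : realType} {disp : measure_display} {I : measurableType disp}.
Variable mu : {measure set I -> \bar R}.

Definition finite_measurable (A : set I) : Prop :=
  measurable A /\ (mu A < +oo)%E.

Let m (A : set I) : R := fine (mu A).

Let mE A : finite_measurable A -> mu A = (m A)%:E.
Proof. by move=> [_ Afin]; rewrite fineK// ge0_fin_numE. Qed.

Lemma finite_measurable_sub A B :
  finite_measurable A -> measurable B -> B `<=` A -> finite_measurable B.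
Proof.
move=> [mA fA] mB BA; split=> //; apply: le_lt_trans fA.
by apply: le_measure; rewrite ?inE.
Qed.

Lemma finite_measurableU A B :
  finite_measurable A -> finite_measurable B -> finite_measurable (A `|` B).
Proof.
move=> [mA fA] [mB fB]; split; first exact: measurableU.
exact: le_lt_trans (measureU2 mu mA mB) (lte_add_pinfty fA fB).
Qed.

Lemma finite_measurableI A B :
  finite_measurable A -> finite_measurable B -> finite_measurable (A `&` B).
Proof.
move=> fA [mB _]; apply: (finite_measurable_sub fA) => //.
by apply: measurableI => //; case: fA.
Qed.

Lemma finite_measurableY A B :
  finite_measurable A -> finite_measurable B -> finite_measurable (A `+` B).
Proof.
move=> fA fB; apply: (finite_measurable_sub (finite_measurableU fA fB)).
  by case: fA => mA _; case: fB => mB _; apply: measurableU; exact: measurableD.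
by move=> x /= [[]|[]]; tauto.
Qed.

Let m_le A B :
  finite_measurable A -> finite_measurable B -> A `<=` B -> m A <= m B.
Proof.
move=> fA fB AB; rewrite -lee_fin -!mE//.
by apply: le_measure; rewrite ?inE//; [case: fA|case: fB].
Qed.

Let mU A B : finite_measurable A -> finite_measurable B ->
  m A + m B = m (A `|` B) + m (A `&` B).
Proof.
move=> fA fB; have [mA _] := fA; have [mB fB'] := fB.
have : mu (A `|` B) = (mu A + mu B - mu (A `&` B))%E := measureUfinr mA mB fB'.
rewrite (mE (finite_measurableU fA fB)) (mE (finite_measurableI fA fB)).
by rewrite (mE fA) (mE fB) => -[->]; rewrite subrK.
Qed.

Let m_ge0 A : 0 <= m A. Proof. exact: fine_ge0. Qed.

Definition finite_measurable_set : Type := {A : set I | finite_measurable A}.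

Definition symdiff_dist (A B : finite_measurable_set) : R :=
  fine (mu (sval A `+` sval B)).

(** By inclusion-exclusion the distances from A to M and from M to B add up to the
  distance from A to B plus twice the measure of the set on which M differs from
  both A and B. *)
Lemma between_symdiffP (A M B : finite_measurable_set) :
  between symdiff_dist A M B <->
  mu ((sval A `+` sval M) `&` (sval M `+` sval B)) = 0%E.
Proof.
rewrite /between /symdiff_dist -!/(m _).
move: A M B => [A fA] [M fM] [B fB] /=.
have fAM := finite_measurableY fA fM.
have fMB := finite_measurableY fM fB.
have fAB := finite_measurableY fA fB.
have fU := finite_measurableU fAM fMB.
have fI := finite_measurableI fAM fMB.
have ABU : A `+` B `<=` (A `+` M) `|` (M `+` B).
  by move=> w /=; have [] := pselect (M w); tauto.
have UAB : (A `+` M) `|` (M `+` B) `<=`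
           (A `+` B) `|` ((A `+` M) `&` (M `+` B)).
  move=> w /=; have [] := pselect (M w); have [] := pselect (A w).
    by have [] := pselect (B w); tauto.
    by have [] := pselect (B w); tauto.
    by have [] := pselect (B w); tauto.
  by have [] := pselect (B w); tauto.
have := mU fAM fMB; have := m_le fAB fU ABU.
have := m_le fU (finite_measurableU fAB fI) UAB.
have := mU fAB fI; have := m_ge0 ((A `+` B) `&` ((A `+` M) `&` (M `+` B))).
have := m_ge0 ((A `+` M) `&` (M `+` B)).
rewrite (mE fI); set i := m (_ `&` _); move=> *.
by split=> [h|[h]]; [congr EFin|]; lra.
Qed.

(** The majority set is a median.  For uniqueness, where two medians M and M'
  differ, one of them disagrees with two of the sets A, B, C that agree with each
  other, which happens on a null set only. *)
Lemma symdiff_pseudo_median : pseudo_median symdiff_dist.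
Proof.
split.
- by move=> A; rewrite /symdiff_dist setYK measure0.
- by move=> A B; rewrite /symdiff_dist setYC.
- move=> [A fA] [B fB] [C fC]; rewrite /symdiff_dist /=.
  rewrite -!/(m _).
  have fAB := finite_measurableY fA fB.
  have fBC := finite_measurableY fB fC.
  have fAC := finite_measurableY fA fC.
  rewrite mU//; apply: (@le_trans _ _ (m ((A `+` B) `|` (B `+` C)))).
    apply: m_le => //; first exact: finite_measurableU.
    by move=> w /=; have [] := pselect (B w); tauto.
  by rewrite lerDl; exact: m_ge0.
- move=> [A fA] [B fB] [C fC].
  have fM : finite_measurable ((A `&` B) `|` (B `&` C) `|` (A `&` C)).
    by do 2?[apply: finite_measurableU]; apply: finite_measurableI.
  exists (exist _ _ fM).
  split; apply/between_symdiffP => /=; rewrite -[RHS](measure0 mu); congr (mu _);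
    by apply/seteqP; split=> // w /=; tauto.
- move=> [A fA] [B fB] [C fC] [M fM] [M' fM'].
  move=> [/between_symdiffP h1 /between_symdiffP h2 /between_symdiffP h3].
  move=> [/between_symdiffP h4 /between_symdiffP h5 /between_symdiffP h6].
  rewrite /symdiff_dist /=; move: h1 h2 h3 h4 h5 h6 => /=.
  set N1 := _ `&` _; set N2 := _ `&` _; set N3 := _ `&` _.
  set N4 := _ `&` _; set N5 := _ `&` _; set N6 := _ `&` _.
  have fN P Q S : finite_measurable P -> finite_measurable Q ->
      finite_measurable S -> measurable ((P `+` Q) `&` (Q `+` S)).
    by move=> fP fQ fS; case: (finite_measurableI (finite_measurableY fP fQ)
      (finite_measurableY fQ fS)).
  have mU0 P Q : measurable P -> measurable Q -> mu P = 0%E -> mu Q = 0%E ->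
      mu (P `|` Q) = 0%E.
    by move=> mP mQ P0 Q0; rewrite measureU0.
  have [mN1 mN2 mN3] : [/\ measurable N1, measurable N2 & measurable N3].
    by split; apply: fN.
  have [mN4 mN5 mN6] : [/\ measurable N4, measurable N5 & measurable N6].
    by split; apply: fN.
  move=> h1 h2 h3 h4 h5 h6.
  suff -> : mu (M `+` M') = 0%E by [].
  apply: (@subset_measure0 _ _ _ mu _
    (((N1 `|` N2) `|` N3) `|` ((N4 `|` N5) `|` N6))).
  + by case: (finite_measurableY fM fM').
  + by do ![apply: (measurableU) | assumption].
  + rewrite /N1 /N2 /N3 /N4 /N5 /N6 => w /=.
    have [] := pselect (A w); have [] := pselect (B w); have [] := pselect (C w);
    by have [] := pselect (M w); have [] := pselect (M' w); tauto.
  + by do ![apply: (mU0) | apply: (measurableU) => // | assumption].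
Qed.

End FiniteMeasureSets.

(** The symmetric difference of the sets of walls separating x0 from x and x0 from
  y is the set of walls separating x from y. *)
Lemma wall_metric_pseudo_median (R : realType) (X : Type) (d : X -> X -> R)
    (x0 : X) : wall_metric d ->
  exists (T : Type) (dT : T -> T -> R) (f : X -> T),
    pseudo_median dT /\ (forall x y, dT (f x) (f y) = d x y).
Proof.
move=> [S dS].
pose W x y := [set w | separates (@mw_wall _ _ S w) x y].
have fW x y : finite_measurable (mw_measure S) (W x y).
  by split; [exact: mw_measurable|exact: mw_finite].
exists (finite_measurable_set (mw_measure S)).
exists (@symdiff_dist _ _ _ (mw_measure S)).
exists (fun x => exist _ _ (fW x0 x)).
split; first exact: symdiff_pseudo_median.
move=> x y; rewrite /symdiff_dist /=.
have -> : W x0 x `+` W x0 y = W x y.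
  apply/seteqP; split=> w; rewrite /W /=; have [h wE] := mw_is_wall w;
    have sepE u v : separates (mw_wall w) u v <-> (h u /\ ~ h v \/ h v /\ ~ h u)
      by [rewrite /separates wE; split=> [[k [->|->]] /= |[[hu hv]|[hv hu]]];
      [tauto | have [] := pselect (h v); tauto |
       exists h; [left|split] | exists (~` h); [right|split=> //; exact]]];
    rewrite !sepE;
    have [] := pselect (h x0); have [] := pselect (h x);
    by have [] := pselect (h y); tauto.
by rewrite -dS.
Qed.

(** * The unit ball of C^2 in real coordinates *)

Section RealCoordinates.
Variable R : realType.

Definition C2 : Type := ((R * R) * (R * R))%type.
Implicit Types p q w z : C2.

Definition sqn p : R := p.1.1 ^+ 2 + p.1.2 ^+ 2 + p.2.1 ^+ 2 + p.2.2 ^+ 2.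

(** Real and imaginary parts of <p, q> - 1, where <p, q> is the Hermitian product
  of C^2; [hsq] is the squared modulus. *)
Definition hre p q : R :=
  p.1.1 * q.1.1 + p.1.2 * q.1.2 + (p.2.1 * q.2.1 + p.2.2 * q.2.2) - 1.

Definition him p q : R :=
  p.1.2 * q.1.1 - p.1.1 * q.1.2 + (p.2.2 * q.2.1 - p.2.1 * q.2.2).

Definition hsq p q : R := hre p q ^+ 2 + him p q ^+ 2.

(** The point alpha p + (1 - alpha) q with the complex coefficient
  alpha = a + i b. *)
Definition affine (a b : R) p q : C2 :=
  ((q.1.1 + a * (p.1.1 - q.1.1) - b * (p.1.2 - q.1.2),
    q.1.2 + a * (p.1.2 - q.1.2) + b * (p.1.1 - q.1.1)),
   (q.2.1 + a * (p.2.1 - q.2.1) - b * (p.2.2 - q.2.2),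
    q.2.2 + a * (p.2.2 - q.2.2) + b * (p.2.1 - q.2.1))).

Definition weight (t : R) p q : R :=
  (1 - t * hre p q) ^+ 2 + (t * him p q) ^+ 2.

(** With h = <p, q> - 1, the lifts (p, 1) and - t h (q, 1) have a negative
  Hermitian product, so their sum is a lift of a point on the geodesic from p to
  q.  In the ball this is alpha p + (1 - alpha) q with alpha = 1 / (1 - t h), and
  [weight] is |1 - t h|^2. *)
Definition geodesic p q (t : R) : C2 :=
  affine ((1 - t * hre p q) / weight t p q) (t * him p q / weight t p q) p q.

Lemma hreC p q : hre p q = hre q p.
Proof. by case: p q => [[? ?] [? ?]] [[? ?] [? ?]]; rewrite /hre /=; ring. Qed.

Lemma himC p q : him p q = - him q p.
Proof. by case: p q => [[? ?] [? ?]] [[? ?] [? ?]]; rewrite /him /=; ring. Qed.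

Lemma hre_self p : hre p p = - (1 - sqn p).
Proof. by case: p => [[? ?] [? ?]]; rewrite /hre /sqn /=; ring. Qed.

Lemma him_self p : him p p = 0.
Proof. by case: p => [[? ?] [? ?]]; rewrite /him /=; ring. Qed.

Lemma hre_affine a b p q w :
  hre (affine a b p q) w =
  a * hre p w - b * him p w + ((1 - a) * hre q w + b * him q w).
Proof.
by case: p q w => [[? ?] [? ?]] [[? ?] [? ?]] [[? ?] [? ?]];
  rewrite /affine /hre /him /=; ring.
Qed.

Lemma him_affine a b p q w :
  him (affine a b p q) w =
  a * him p w + b * hre p w + ((1 - a) * him q w - b * hre q w).
Proof.
by case: p q w => [[? ?] [? ?]] [[? ?] [? ?]] [[? ?] [? ?]];
  rewrite /affine /hre /him /=; ring.
Qed.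

Lemma sqn_affine a b p q :
  1 - sqn (affine a b p q) =
  (a ^+ 2 + b ^+ 2) * (1 - sqn p) + ((1 - a) ^+ 2 + b ^+ 2) * (1 - sqn q)
  - 2 * ((a * (1 - a) - b ^+ 2) * hre p q - b * him p q).
Proof.
by case: p q => [[? ?] [? ?]] [[? ?] [? ?]];
  rewrite /affine /hre /him /sqn /=; ring.
Qed.

Lemma affine_affine a b a' b' p q :
  affine a b (affine a' b' p q) q =
  affine (a * a' - b * b') (a * b' + b * a') p q.
Proof.
by case: p q => [[? ?] [? ?]] [[? ?] [? ?]]; rewrite /affine /=;
  congr (_, _, (_, _)); ring.
Qed.

Lemma affine1 p q : affine 1 0 p q = p.
Proof.
by case: p q => [[? ?] [? ?]] [[? ?] [? ?]]; rewrite /affine /=;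
  congr (_, _, (_, _)); ring.
Qed.

Lemma sqn_ge0 p : 0 <= sqn p.
Proof. by rewrite /sqn !addr_ge0// sqr_ge0. Qed.

Lemma hsq_ge0 p q : 0 <= hsq p q.
Proof. by rewrite /hsq addr_ge0// sqr_ge0. Qed.

Lemma hre_lt0 p q : sqn p < 1 -> sqn q < 1 -> hre p q < 0.
Proof.
case: p q => [[a b] [c e]] [[a' b'] [c' e']]; rewrite /sqn /hre /= => h h'.
have := sqr_ge0 (a - a'); have := sqr_ge0 (b - b').
have := sqr_ge0 (c - c'); have := sqr_ge0 (e - e'); lra.
Qed.

Lemma weight_gt0 t p q : 0 <= t -> sqn p < 1 -> sqn q < 1 -> 0 < weight t p q.
Proof.
move=> t0 hp hq; have h := hre_lt0 hp hq; rewrite /weight.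
have := sqr_ge0 (t * him p q); have : 1 <= 1 - t * hre p q by nra.
by move: (1 - _) => u; nra.
Qed.

Lemma sqn_geodesic t p q : weight t p q != 0 ->
  (1 - sqn (geodesic p q t)) * weight t p q =
  1 - sqn p + 2 * t * hsq p q + t ^+ 2 * hsq p q * (1 - sqn q).
Proof.
move=> w0; rewrite sqn_affine /hsq; move: w0; rewrite /weight.
by move: (hre p q) (him p q) (sqn p) (sqn q) => x y u v w0; field.
Qed.

Lemma sqn_geodesic_lt1 t p q :
  0 <= t -> sqn p < 1 -> sqn q < 1 -> sqn (geodesic p q t) < 1.
Proof.
move=> t0 hp hq; have w0 := weight_gt0 t0 hp hq.
have := sqn_geodesic (lt0r_neq0 w0) => h.
have := hsq_ge0 p q => h2.
have : 0 < (1 - sqn (geodesic p q t)) * weight t p q.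
  by rewrite h; have : 0 <= t ^+ 2 * hsq p q * (1 - sqn q); [
    rewrite !mulr_ge0 ?sqr_ge0//; lra | have := mulr_ge0 t0 h2; lra].
by rewrite (pmulr_lgt0 _ w0); lra.
Qed.

(** * Hulls of finitely many points *)

Definition geodesically_convex (S : set C2) : Prop :=
  forall p q t, sqn p < 1 -> sqn q < 1 -> 0 <= t -> S p -> S q ->
  S (geodesic p q t).

(** When <p, q> is real, the geodesic from p to q is a straight segment, as in the
  Klein model. *)
Lemma convex_segment (S : set C2) p q (l : R) :
    geodesically_convex S -> sqn p < 1 -> sqn q < 1 -> him p q = 0 ->
    0 <= l <= 1 -> S p -> S q ->
  S (affine l 0 p q).
Proof.
move=> cS hp hq h0 /andP[l0 l1] Sp Sq.
have [->|lN0] := eqVneq l 0.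
  suff -> : affine 0 0 p q = q by [].
  by case: p q {hp hq h0 Sp Sq} => [[? ?] [? ?]] [[? ?] [? ?]];
    rewrite /affine /=; congr (_, _, (_, _)); ring.
have hre0 := hre_lt0 hp hq; have hN0 : hre p q != 0 by rewrite lt_eqF.
pose t := (l^-1 - 1) / - hre p q.
have lgt0 : 0 < l by rewrite lt0r lN0.
have lV : 1 <= l^-1 by rewrite invf_ge1.
have t0 : 0 <= t.
  by rewrite divr_ge0 ?oppr_ge0 ?subr_ge0// ltW.
suff <- : geodesic p q t = affine l 0 p q by apply: cS.
have tE : 1 - t * hre p q = l^-1 by rewrite /t; field; rewrite lN0 hN0.
by rewrite /geodesic /weight h0 mulr0 mul0r tE; congr affine; field.
Qed.

Definition midpoint p q : C2 :=
  (((p.1.1 + q.1.1) / 2, (p.1.2 + q.1.2) / 2),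
   ((p.2.1 + q.2.1) / 2, (p.2.2 + q.2.2) / 2)).

Lemma convex_midpoint (S : set C2) p q :
    geodesically_convex S -> sqn p < 1 -> sqn q < 1 -> him p q = 0 ->
  S p -> S q -> S (midpoint p q).
Proof.
move=> cS hp hq h0 Sp Sq.
suff -> : midpoint p q = affine 2^-1 0 p q.
  by apply: convex_segment => //; apply/andP; split; lra.
by case: p q {hp hq h0 Sp Sq} => [[? ?] [? ?]] [[? ?] [? ?]];
  rewrite /affine /midpoint /=; congr (_, _, (_, _)); field.
Qed.

Definition axis_points : seq C2 :=
  [:: ((2^-1, 0), (0, 0)); ((- 2^-1, 0), (0, 0));
      ((0, 2^-1), (0, 0)); ((0, - 2^-1), (0, 0));
      ((0, 0), (2^-1, 0)); ((0, 0), (- 2^-1, 0));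
      ((0, 0), (0, 2^-1)); ((0, 0), (0, - 2^-1))].

(** Straight segments suffice.  The coordinate planes of real points and of purely
  imaginary points are filled first.  For w = x + i y take a small real c: the
  points (2 x, 2 c) and (2 i y, - 2 i x y / c) have a real Hermitian product, so
  their midpoint (w, c - i x y / c) is reached; so is the same point with c
  replaced by - c, and (w, 0) is the midpoint of the two. *)
Lemma disc_in_hull (S : set C2) (x y : R) :
    geodesically_convex S -> (forall p, List.In p axis_points -> S p) ->
    - 8^-1 <= x <= 8^-1 -> - 8^-1 <= y <= 8^-1 ->
  S ((x, y), (0, 0)).
Proof.
move=> cS Sa /andP[x0 x1] /andP[y0 y1].
have mid p q m : sqn p < 1 -> sqn q < 1 -> him p q = 0 -> midpoint p q = m ->
    S p -> S q -> S m.
  by move=> *; subst m; apply: convex_midpoint.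
have seg (p q m : C2) (u : R) : sqn p < 1 -> sqn q < 1 -> him p q = 0 ->
    - 2^-1 <= u <= 2^-1 -> affine (2^-1 + u) 0 p q = m -> S p -> S q -> S m.
  move=> hp hq h0 /andP[u0 u1] <- Sp Sq; apply: convex_segment => //.
  by apply/andP; split; lra.
have ax1 u : - 2^-1 <= u <= 2^-1 -> S ((u, 0), (0, 0)).
  move=> hu; apply: (seg ((2^-1, 0), (0, 0)) ((- 2^-1, 0), (0, 0)) _ u) => //.
  - by rewrite /sqn /=; lra.
  - by rewrite /sqn /=; lra.
  - by rewrite /him /=; ring.
  - by rewrite /affine /=; congr (_, _, (_, _)); field.
  - by apply: Sa; rewrite /=; tauto.
  - by apply: Sa; rewrite /=; tauto.
have ax2 u : - 2^-1 <= u <= 2^-1 -> S ((0, u), (0, 0)).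
  move=> hu; apply: (seg ((0, 2^-1), (0, 0)) ((0, - 2^-1), (0, 0)) _ u) => //.
  - by rewrite /sqn /=; lra.
  - by rewrite /sqn /=; lra.
  - by rewrite /him /=; ring.
  - by rewrite /affine /=; congr (_, _, (_, _)); field.
  - by apply: Sa; rewrite /=; tauto.
  - by apply: Sa; rewrite /=; tauto.
have ax3 u : - 2^-1 <= u <= 2^-1 -> S ((0, 0), (u, 0)).
  move=> hu; apply: (seg ((0, 0), (2^-1, 0)) ((0, 0), (- 2^-1, 0)) _ u) => //.
  - by rewrite /sqn /=; lra.
  - by rewrite /sqn /=; lra.
  - by rewrite /him /=; ring.
  - by rewrite /affine /=; congr (_, _, (_, _)); field.
  - by apply: Sa; rewrite /=; tauto.
  - by apply: Sa; rewrite /=; tauto.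
have ax4 u : - 2^-1 <= u <= 2^-1 -> S ((0, 0), (0, u)).
  move=> hu; apply: (seg ((0, 0), (0, 2^-1)) ((0, 0), (0, - 2^-1)) _ u) => //.
  - by rewrite /sqn /=; lra.
  - by rewrite /sqn /=; lra.
  - by rewrite /him /=; ring.
  - by rewrite /affine /=; congr (_, _, (_, _)); field.
  - by apply: Sa; rewrite /=; tauto.
  - by apply: Sa; rewrite /=; tauto.
have real_plane u v : - 4^-1 <= u <= 4^-1 -> - 4^-1 <= v <= 4^-1 ->
    S ((u, 0), (v, 0)).
  move=> /andP[? ?] /andP[? ?].
  apply: (mid ((2 * u, 0), (0, 0)) ((0, 0), (2 * v, 0))).
  - by rewrite /sqn /=; nra.
  - by rewrite /sqn /=; nra.
  - by rewrite /him /=; ring.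
  - by rewrite /midpoint /=; congr (_, _, (_, _)); field.
  - by apply: ax1; apply/andP; split; lra.
  - by apply: ax3; apply/andP; split; lra.
have imag_plane u v : - 4^-1 <= u <= 4^-1 -> - 4^-1 <= v <= 4^-1 ->
    S ((0, u), (0, v)).
  move=> /andP[? ?] /andP[? ?].
  apply: (mid ((0, 2 * u), (0, 0)) ((0, 0), (0, 2 * v))).
  - by rewrite /sqn /=; nra.
  - by rewrite /sqn /=; nra.
  - by rewrite /him /=; ring.
  - by rewrite /midpoint /=; congr (_, _, (_, _)); field.
  - by apply: ax2; apply/andP; split; lra.
  - by apply: ax4; apply/andP; split; lra.
have xy0 : - 64^-1 <= x * y by nra.
have xy1 : x * y <= 64^-1 by nra.
(* Here c is 1/8 or - 1/8, so 1/c is written 64 c. *)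
have lifted (c : R) : c ^+ 2 = 64^-1 -> S ((x, y), (c, - 64 * (c * (x * y)))).
  move=> hc; have c0 : - 8^-1 <= c by nra.
  have c1 : c <= 8^-1 by nra.
  have v0 : - 4^-1 <= - 128 * (c * (x * y)) by nra.
  have v1 : - 128 * (c * (x * y)) <= 4^-1 by nra.
  apply: (mid ((2 * x, 0), (2 * c, 0))
              ((0, 2 * y), (0, - 128 * (c * (x * y))))).
  - by rewrite /sqn /=; nra.
  - by rewrite /sqn /=; nra.
  - rewrite /him /=; transitivity (- 4 * (x * y) * (1 - 64 * c ^+ 2)).
      by ring.
    by rewrite hc; field.
  - by rewrite /midpoint /=; congr (_, _, (_, _)); field.
  - by apply: real_plane; apply/andP; split; lra.
  - by apply: imag_plane; apply/andP; split; lra.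
have v0 : - 8^-1 <= - 8 * (x * y) by lra.
have v1 : - 8 * (x * y) <= 8^-1 by lra.
apply: (mid ((x, y), (8^-1, - 64 * (8^-1 * (x * y))))
            ((x, y), (- 8^-1, - 64 * (- 8^-1 * (x * y))))).
- by rewrite /sqn /=; nra.
- by rewrite /sqn /=; nra.
- by rewrite /him /=; ring.
- by rewrite /midpoint /=; congr (_, _, (_, _)); field.
- by apply: lifted; field.
- by apply: lifted; field.
Qed.

Definition swap p : C2 := (p.2, p.1).

Lemma geodesic_swap p q t : geodesic (swap p) (swap q) t = swap (geodesic p q t).
Proof.
have hS : hre (swap p) (swap q) = hre p q by rewrite /hre /=; ring.
have iS : him (swap p) (swap q) = him p q by rewrite /him /=; ring.
by rewrite /geodesic /weight hS iS.
Qed.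

Lemma sqn_swap p : sqn (swap p) = sqn p.
Proof. by rewrite /sqn /=; ring. Qed.

(** (z1, z2) is the midpoint of (2 z1, 0) and (0, 2 z2), whose Hermitian product
  vanishes. *)
Lemma ball_in_hull (S : set C2) :
    geodesically_convex S -> (forall p, List.In p axis_points -> S p) ->
  forall z, sqn z < 256^-1 -> S z.
Proof.
move=> cS Sa z; case: z => [[a b] [c e]]; rewrite /sqn /= => hz.
have cS' : geodesically_convex [set p | S (swap p)].
  move=> p q t hp hq t0 /= Sp Sq; rewrite -geodesic_swap.
  by apply: cS => //; rewrite sqn_swap.
have Sa' p : List.In p axis_points -> S (swap p).
  by move=> /= [<-|[<-|[<-|[<-|[<-|[<-|[<-|[<-|[]]]]]]]]]; apply: Sa => /=; tauto.
have small (u v : R) : u ^+ 2 + v < 256^-1 -> 0 <= v ->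
    - 8^-1 <= 2 * u <= 8^-1.
  by move=> *; apply/andP; split; nra.
have := sqr_ge0 a; have := sqr_ge0 b; have := sqr_ge0 c; have := sqr_ge0 e.
move=> e0 c0 b0 a0.
have Sz1 : S ((2 * a, 2 * b), (0, 0)).
  apply: disc_in_hull => //.
    by apply: (small _ (b ^+ 2 + c ^+ 2 + e ^+ 2)); lra.
  by apply: (small _ (a ^+ 2 + c ^+ 2 + e ^+ 2)); lra.
have Sz2 : S ((0, 0), (2 * c, 2 * e)).
  apply: (disc_in_hull cS') => //.
    by apply: (small _ (a ^+ 2 + b ^+ 2 + e ^+ 2)); lra.
  by apply: (small _ (a ^+ 2 + b ^+ 2 + c ^+ 2)); lra.
suff <- : midpoint ((2 * a, 2 * b), (0, 0)) ((0, 0), (2 * c, 2 * e)) =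
    ((a, b), (c, e)).
  apply: convex_midpoint => //.
  - by rewrite /sqn /=; lra.
  - by rewrite /sqn /=; lra.
  - by rewrite /him /=; ring.
by rewrite /midpoint /=; congr (_, _, (_, _)); field.
Qed.

(** * Supporting hypersurfaces *)

Let cont (f : C2 -> R) : Prop := continuous f.

Let contD f g : cont f -> cont g -> cont (fun x => f x + g x).
Proof. by move=> cf cg x; apply: cvgD; [exact: cf|exact: cg]. Qed.

Let contM f g : cont f -> cont g -> cont (fun x => f x * g x).
Proof. by move=> cf cg x; apply: cvgM; [exact: cf|exact: cg]. Qed.

Let contN f : cont f -> cont (fun x => - f x).
Proof. by move=> cf x; apply: cvgN; exact: cf. Qed.

Let contX f n : cont f -> cont (fun x => f x ^+ n).
Proof.
move=> cf; elim: n => [|n IH]; first by move=> x; exact: cvg_cst.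
under eq_fun do rewrite exprS.
exact: contM.
Qed.

Let contC (c : R) : cont (fun=> c).
Proof. by move=> x; exact: cvg_cst. Qed.

Let cont11 : cont (fun p : C2 => p.1.1).
Proof. by move=> x; apply: (cvg_comp fst fst); exact: cvg_fst. Qed.

Let cont12 : cont (fun p : C2 => p.1.2).
Proof. by move=> x; apply: (cvg_comp fst snd); [exact: cvg_fst|exact: cvg_snd]. Qed.

Let cont21 : cont (fun p : C2 => p.2.1).
Proof. by move=> x; apply: (cvg_comp snd fst); [exact: cvg_snd|exact: cvg_fst]. Qed.

Let cont22 : cont (fun p : C2 => p.2.2).
Proof. by move=> x; apply: (cvg_comp snd snd); exact: cvg_snd. Qed.

Ltac continuous_poly :=
  repeat lazymatch goal with
  | |- cont (fun x => @?f x + @?g x) => apply: (@contD f g)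
  | |- cont (fun x => - @?f x) => apply: (@contN f)
  | |- cont (fun x => @?f x * @?g x) => apply: (@contM f g)
  | |- cont (fun x => @?f x ^+ ?n) => apply: (@contX f n)
  | |- cont (fun x => x.1.1) => exact: cont11
  | |- cont (fun x => x.1.2) => exact: cont12
  | |- cont (fun x => x.2.1) => exact: cont21
  | |- cont (fun x => x.2.2) => exact: cont22
  | |- cont (fun x => ?c) => exact: contC
  end.

Lemma sqn_continuous : cont sqn.
Proof. by rewrite /sqn; continuous_poly. Qed.

Lemma nearest_point (C : set C2) y : C y -> sqn y < 1 ->
  exists p, [/\ sqn p < 1, closure C p & forall z, C z -> sqn p <= sqn z].
Proof.
move=> Cy y1.
pose K := closure C `&` [set z | sqn z <= sqn y].
have clK : closed K.
  apply: closedI; first exact: closed_closure.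
  have /continuous_closedP h := sqn_continuous.
  exact: h (@closed_le _ _).
have cK : compact K.
  pose I : set R := `[-1, 1]%classic.
  apply: (subclosed_compact clK (B := (I `*` I) `*` (I `*` I))).
    by apply: compact_setX; apply: compact_setX; apply: segment_compact.
  move=> [[a b] [c e]] [_ /le_lt_trans/(_ y1)]; rewrite /sqn /= => h.
  have := sqr_ge0 a; have := sqr_ge0 b; have := sqr_ge0 c; have := sqr_ge0 e.
  move=> e0 c0 b0 a0.
  have bd (u : R) : u ^+ 2 <= 1 -> I u.
    by move=> hu; rewrite /I /= in_itv /=; apply/andP; split; nra.
  by split; split; apply: bd => /=; lra.
have K0 : K !=set0 by exists y; split=> //=; apply: subset_closure.
have [p] := compact_EVT_min K0 cK (continuous_subspaceT sqn_continuous).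
rewrite inE => -[clp /= py] pmin.
exists p; split=> //; first exact: le_lt_trans y1.
move=> z Cz; have [zy|/ltW yz] := leP (sqn z) (sqn y).
  by apply: pmin; rewrite inE; split=> //; apply: subset_closure.
exact: le_trans yz.
Qed.

(** With h = <p, q> - 1, this is - 1/2 times the derivative at t = 0 of |z|^2 along
  the geodesic z from p to q: it is positive when the geodesic starts into the
  ball of radius |p|. *)
Definition tangent_form p q : R :=
  hsq p q + (1 - sqn p) * hre p q.

Section Tangent.
Variable S : set C2.
Hypothesis S_convex : geodesically_convex S.
Hypothesis SC_convex : geodesically_convex (~` S).
Variable p : C2.
Hypothesis p1 : sqn p < 1.
Hypothesis p_closure : closure [set z | sqn z < 1 /\ ~ S z] p.
Hypothesis p_min : forall z, sqn z < 1 -> ~ S z -> sqn p <= sqn z.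

(** For q outside S, points of the complement of S near p would be joined to q by
  geodesics that enter the ball of radius |p|, against the minimality of p. *)
Lemma tangent_form_gt0 q : sqn q < 1 -> 0 < tangent_form p q -> S q.
Proof.
move=> q1 Fq; apply: contrapT => nSq.
have eta0 := hsq_ge0 p q; have sp0 := sqn_ge0 p; have sq0 := sqn_ge0 q.
(* Small enough for the linear term in t to win in [G p]. *)
pose t := tangent_form p q / (1 + hsq p q).
have t0 : 0 < t by rewrite divr_gt0 //; lra.
have tE : t * (1 + hsq p q) = tangent_form p q.
  by rewrite /t divfK // gt_eqF //; lra.
(* G x is positive when the point at parameter t on the geodesic from x to q
   has a norm smaller than that of p. *)
pose G x := 1 - sqn x + 2 * t * hsq x q + t ^+ 2 * hsq x q * (1 - sqn q)
            - (1 - sqn p) * weight t x q.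
have Gc : cont G.
  rewrite /G /weight /hsq /hre /him /sqn; continuous_poly.
have Gp : 0 < G p.
  have -> : G p = t * (2 * tangent_form p q - t * hsq p q * (sqn q - sqn p)).
    by rewrite /G /weight /tangent_form /hsq; ring.
  rewrite mulr_gt0// subr_gt0.
  have : t * hsq p q * (sqn q - sqn p) <= t * hsq p q.
    by rewrite ler_piMr ?(mulr_ge0 (ltW t0) eta0)//; lra.
  by move: tE Fq t0; rewrite mulrDr mulr1; lra.
have [x [[x1 nSx] Gx]] := p_closure (cvgr_gt _ (Gc p) _ Gp).
have t0' := ltW t0.
have := sqn_geodesic (lt0r_neq0 (weight_gt0 t0' x1 q1)).
have := p_min (sqn_geodesic_lt1 t0' x1 q1) (SC_convex x1 q1 t0' nSx nSq).
have := weight_gt0 t0' x1 q1; move: Gx; rewrite /G.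
move=> Gx w0 pg gE; move: Gx; rewrite -gE -mulrBl pmulr_lgt0 //.
by move: pg; lra.
Qed.

(** The geodesic from q to p continues beyond p into the side where
  [tangent_form p] is positive, which is contained in S.  The same holds for the
  geodesic from q to a point x of the complement of S near p, so q in S would put
  x in S. *)
Lemma tangent_form_lt0 q : sqn q < 1 -> tangent_form p q < 0 -> ~ S q.
Proof.
move=> q1 Fq Sq.
have eta0 := hsq_ge0 p q; have sp0 := sqn_ge0 p; have sq0 := sqn_ge0 q.
pose A := 1 - sqn p; have A0 : 0 < A by rewrite subr_gt0.
(* The continuation of the geodesic from q beyond x is represented by the
   point q' = (x + s h q) / (1 + s h), where h = <x, q> - 1. *)
pose s := A / (4 * (1 + hsq p q)).
have s0 : 0 < s by rewrite divr_gt0 //; lra.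
have sE : 4 * (s * (1 + hsq p q)) = A.
  by rewrite /s; field; lra.
pose E x := (1 + s * hre x q) ^+ 2 + (s * him x q) ^+ 2.
pose a x := (1 + s * hre x q) / E x.
pose b x := - (s * him x q) / E x.
pose G1 x := 1 - sqn x + s ^+ 2 * hsq x q * (1 - sqn q) - 2 * s * hsq x q.
(* U1 + i U2 is (1 + s h) (<q', p> - 1), so that G1 and G2 are the numerators
   over E = |1 + s h|^2 of 1 - |q'|^2 and of the tangent form at q'. *)
pose U1 x := hre x p + s * (hre x q * hre q p - him x q * him q p).
pose U2 x := him x p + s * (hre x q * him q p + him x q * hre q p).
pose G2 x := U1 x ^+ 2 + U2 x ^+ 2 +
             A * (U1 x * (1 + s * hre x q) + U2 x * (s * him x q)).
have hq2 : hre p q ^+ 2 <= hsq p q by rewrite /hsq lerDl sqr_ge0.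
have sh : - A <= 8 * (s * hre p q).
  have : 0 <= s * (1 + hre p q) ^+ 2 by rewrite mulr_ge0 ?sqr_ge0 ?(ltW s0).
  have : 0 <= s * (hsq p q - hre p q ^+ 2).
    by rewrite mulr_ge0 ?(ltW s0)// subr_ge0.
  by move: sE; nra.
have seta : 0 <= s * hsq p q by rewrite mulr_ge0 ?(ltW s0).
have Ep : 0 < E p.
  have : 0 < 1 + s * hre p q by move: sh; rewrite /A; lra.
  by rewrite /E; move: (1 + _) => u u0; rewrite ltr_pwDl ?exprn_gt0 ?sqr_ge0.
have A1 : A <= 1 by rewrite /A; lra.
have sB : s * (1 - sqn q) < 1.
  have : s * (1 - sqn q) <= s by rewrite ler_piMr ?(ltW s0)//; lra.
  by move: sE seta; rewrite mulrDr mulr1; lra.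
have G1p : 0 < G1 p.
  have : 0 <= s ^+ 2 * hsq p q * (1 - sqn q).
    by apply: mulr_ge0; rewrite ?subr_ge0 ?(ltW q1)// mulr_ge0 ?sqr_ge0.
  have -> : G1 p = A + s ^+ 2 * hsq p q * (1 - sqn q) - 2 * (s * hsq p q).
    by rewrite /G1 /A; ring.
  by move: sE s0 A0; rewrite mulrDr mulr1; lra.
have G2p : 0 < G2 p.
  have -> : G2 p = (A - s * hsq p q) * (s * - tangent_form p q).
    rewrite /G2 /U1 /U2 !hre_self him_self (hreC q p) (himC q p).
    by rewrite /tangent_form /hsq -/A; ring.
  apply: mulr_gt0; last by rewrite mulr_gt0 ?oppr_gt0.
  by move: sE s0 A0; rewrite mulrDr mulr1; lra.
have cE : cont E by rewrite /E /hre /him; continuous_poly.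
have cG1 : cont G1 by rewrite /G1 /hsq /hre /him /sqn; continuous_poly.
have cG2 : cont G2 by rewrite /G2 /U1 /U2 /hre /him; continuous_poly.
have [x [[x1 nSx] [[Ex G1x] G2x]]] : [set z | sqn z < 1 /\ ~ S z] `&`
    ([set x | 0 < E x] `&` [set x | 0 < G1 x] `&` [set x | 0 < G2 x]) !=set0.
  apply: p_closure; do 2?[apply: filterI].
  - exact: (cvgr_gt _ (cE p) _ Ep).
  - exact: (cvgr_gt _ (cG1 p) _ G1p).
  - exact: (cvgr_gt _ (cG2 p) _ G2p).
move: Ex G1x G2x => /= Ex G1x G2x.
have EN0 : E x != 0 by rewrite gt_eqF.
pose q' := affine (a x) (b x) x q.
have q'1 : sqn q' < 1.
  have h : (1 - sqn q') * E x = G1 x.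
    rewrite sqn_affine /G1 /a /b /hsq; move: EN0; rewrite /E.
    by move: (hre x q) (him x q) (sqn x) (sqn q) => u v k l EN0; field.
  by move: G1x; rewrite -h pmulr_lgt0// subr_gt0.
have Sq' : S q'.
  apply: tangent_form_gt0 => //.
  have h : tangent_form p q' * E x = G2 x.
    rewrite /tangent_form /hsq (hreC p) (himC p) sqrrN -/A.
    rewrite hre_affine him_affine /G2 /U1 /U2 /a /b; move: EN0; rewrite /E.
    move: (hre x q) (him x q) (hre x p) (him x p) (hre q p) (him q p).
    by move=> u v k l m n EN0; field.
  by rewrite -(pmulr_lgt0 _ Ex) h.
apply: nSx.
pose t := s / (1 - s * (1 - sqn q)).
have t0 : 0 <= t by rewrite divr_ge0 ?(ltW s0)// subr_ge0 ltW.
suff -> : x = geodesic q' q t by apply: S_convex.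
have B0 : 1 - s * (1 - sqn q) != 0 by rewrite subr_eq0 gt_eqF.
have wr : 1 - t * hre q' q = (1 + s * hre x q) / E x.
  rewrite hre_affine hre_self him_self /t /a /b; move: EN0; rewrite /E => EN0.
  by move: (hre x q) (him x q) (sqn q) EN0 B0 => u v k EN0 B0;
    field; rewrite EN0 B0.
have wi : t * him q' q = s * him x q / E x.
  rewrite him_affine hre_self him_self /t /a /b; move: EN0; rewrite /E => EN0.
  by move: (hre x q) (him x q) (sqn q) EN0 B0 => u v k EN0 B0;
    field; rewrite EN0 B0.
rewrite /geodesic /weight wr wi affine_affine -[LHS](affine1 x q) /a /b.
move: EN0; rewrite /E; move: (hre x q) (him x q) => u v EN0.
by congr affine; field.
Qed.

End Tangent.

(** * Geodesic cuts of the ball are trivial *)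

(** The point (a1 + i a2) p + (b1 + i b2) v, where v = (- conj p2, conj p1) is
  orthogonal to p = (p1, p2) and has the same norm. *)
Definition rotated_point (p : C2) (a1 a2 b1 b2 : R) : C2 :=
  ((a1 * p.1.1 - a2 * p.1.2 + (- b1 * p.2.1 - b2 * p.2.2),
    a1 * p.1.2 + a2 * p.1.1 + (b1 * p.2.2 - b2 * p.2.1)),
   (a1 * p.2.1 - a2 * p.2.2 + (b1 * p.1.1 + b2 * p.1.2),
    a1 * p.2.2 + a2 * p.2.1 + (b2 * p.1.1 - b1 * p.1.2))).

Lemma hre_rotated p a1 a2 b1 b2 c1 c2 e1 e2 :
  hre (rotated_point p a1 a2 b1 b2) (rotated_point p c1 c2 e1 e2) =
  (a1 * c1 + a2 * c2 + b1 * e1 + b2 * e2) * sqn p - 1.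
Proof.
by case: p => [[? ?] [? ?]]; rewrite /hre /rotated_point /sqn /=; ring.
Qed.

Lemma him_rotated p a1 a2 b1 b2 c1 c2 e1 e2 :
  him (rotated_point p a1 a2 b1 b2) (rotated_point p c1 c2 e1 e2) =
  (a2 * c1 - a1 * c2 + b2 * e1 - b1 * e2) * sqn p.
Proof.
by case: p => [[? ?] [? ?]]; rewrite /him /rotated_point /sqn /=; ring.
Qed.

Lemma hre_rotatedl p a1 a2 b1 b2 :
  hre (rotated_point p a1 a2 b1 b2) p = a1 * sqn p - 1.
Proof.
by case: p => [[? ?] [? ?]]; rewrite /hre /rotated_point /sqn /=; ring.
Qed.

Lemma him_rotatedl p a1 a2 b1 b2 :
  him (rotated_point p a1 a2 b1 b2) p = a2 * sqn p.
Proof.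
by case: p => [[? ?] [? ?]]; rewrite /him /rotated_point /sqn /=; ring.
Qed.

Lemma sqn_rotated p a1 a2 b1 b2 :
  sqn (rotated_point p a1 a2 b1 b2) =
  (a1 ^+ 2 + a2 ^+ 2 + b1 ^+ 2 + b2 ^+ 2) * sqn p.
Proof.
by case: p => [[? ?] [? ?]]; rewrite /rotated_point /sqn /=; ring.
Qed.

Lemma tangent_formE p q :
  tangent_form p q =
  hre q p ^+ 2 + him q p ^+ 2 + (1 - sqn p) * hre q p.
Proof. by rewrite /tangent_form /hsq (hreC p) (himC p) sqrrN. Qed.

(** At the nearest point p of the complement, the points q1 = (1 + i e) p - i b v
  and q2 = (1 - i e) p + b v both satisfy tangent_form p q = (e |p|^2)^2 > 0.  The
  imaginary part of <q1, q2> is dominated by - b^2 |p|^2, and it moves the middle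
  of the geodesic from q1 to q2 to the negative side by an amount of first order
  in e, which wins for small e. *)
Lemma convex_cut_trivial (S : set C2) :
    geodesically_convex S -> geodesically_convex (~` S) ->
    (forall p, List.In p axis_points -> S p) ->
  forall z, sqn z < 1 -> S z.
Proof.
move=> cS cSC Sa y y1; apply: contrapT => nSy.
have [p [p1 clp pmin]] := @nearest_point [set z | sqn z < 1 /\ ~ S z] y
  (conj y1 nSy) y1.
have pmin' z : sqn z < 1 -> ~ S z -> sqn p <= sqn z by move=> ? ?; apply: pmin.
have p0 : 0 < sqn p.
  have [//|p0] := ltP 0 (sqn p).
  have psmall : sqn p < 256^-1 by lra.
  have [z [[_ nSz] /= zsmall]] := clp _ (cvgr_lt _ (@sqn_continuous p) _ psmall).
  by case: nSz; apply: ball_in_hull zsmall.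
pose P := sqn p; pose A := 1 - P.
have P0 : 0 < P by [].
have A0 : 0 < A by rewrite /A /P; lra.
have PE : P = 1 - A by rewrite /A; ring.
(* b keeps q1 and q2 in the ball; e is small compared to b^2 and A. *)
pose e := A ^+ 3 / 40; pose b := A / 2.
pose q1 := rotated_point p 1 e 0 (- b).
pose q2 := rotated_point p 1 (- e) b 0.
have A3 : 0 < A ^+ 3 by rewrite exprn_gt0.
have e0 : 0 < e by rewrite /e; lra.
have A3le : A ^+ 3 <= A ^+ 2 by nra.
have A21 : A ^+ 2 <= A by nra.
have eA : e <= A ^+ 2 / 40 by rewrite /e; lra.
have e2 : e ^+ 2 <= A / 40 by rewrite expr2; nra.
have b2 : b ^+ 2 = A ^+ 2 / 4 by rewrite /b; field.
have in_ball : (1 + (e ^+ 2 + b ^+ 2)) * P < 1.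
  have : (e ^+ 2 + b ^+ 2) * P <= e ^+ 2 + b ^+ 2.
    by rewrite ler_piMr ?addr_ge0 ?sqr_ge0// PE; lra.
  by rewrite [X in _ -> X < 1]mulrDl mul1r; lra.
have q11 : sqn q1 < 1.
  by rewrite sqn_rotated -/P; move: in_ball; rewrite !expr0n /= expr1n sqrrN; lra.
have q21 : sqn q2 < 1.
  by rewrite sqn_rotated -/P; move: in_ball; rewrite !expr0n /= expr1n sqrrN; lra.
have hq1 : hre q1 p = - A by rewrite hre_rotatedl -/P /A; ring.
have iq1 : him q1 p = e * P by rewrite him_rotatedl.
have hq2 : hre q2 p = - A by rewrite hre_rotatedl -/P /A; ring.
have iq2 : him q2 p = - (e * P) by rewrite him_rotatedl mulNr.
have h12 : hre q1 q2 = - (A + e ^+ 2 * P).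
  by rewrite hre_rotated -/P /A; ring.
have i12 : him q1 q2 = - ((b ^+ 2 - 2 * e) * P).
  by rewrite him_rotated -/P; ring.
have Sq1 : S q1.
  apply: (tangent_form_gt0 cSC clp pmin') => //.
  rewrite tangent_formE hq1 iq1 -/P -/A.
  by rewrite (_ : _ + _ = (e * P) ^+ 2); [rewrite exprn_gt0// mulr_gt0|ring].
have Sq2 : S q2.
  apply: (tangent_form_gt0 cSC clp pmin') => //.
  rewrite tangent_formE hq2 iq2 -/P -/A.
  by rewrite (_ : _ + _ = (e * P) ^+ 2); [rewrite exprn_gt0// mulr_gt0|ring].
have r1 := sqn_geodesic_lt1 ler01 q11 q21.
apply: (tangent_form_lt0 cS cSC p1 clp pmin' r1); last exact: cS.
have w0 := weight_gt0 ler01 q11 q21.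
rewrite tangent_formE hre_affine him_affine hq1 hq2 iq1 iq2 -/P -/A.
move: w0; rewrite /weight h12 i12 !mul1r opprK sqrrN.
have eP2 : 0 <= e ^+ 2 * P by rewrite mulr_ge0 ?sqr_ge0 ?(ltW P0).
set k := A + e ^+ 2 * P; set m := (b ^+ 2 - 2 * e) * P.
have k0 : 0 < k by rewrite /k; lra.
have P1 : P <= 1 by rewrite PE; lra.
have k2 : k <= 2.
  have : e ^+ 2 * P <= e ^+ 2 * 1 by apply: ler_wpM2l; rewrite ?sqr_ge0.
  by rewrite /k mulr1; lra.
have m0 : A ^+ 2 / 5 * P <= m by rewrite /m ler_pM2r//; lra.
have m1 : m <= 1.
  have : m <= b ^+ 2 - 2 * e by rewrite ler_piMr//; lra.
  by lra.
have A2P : 0 < A ^+ 2 / 5 * P by rewrite !mulr_gt0.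
set w := (1 + k) ^+ 2 + m ^+ 2 => w0.
have w10 : w <= 10 by rewrite /w; nra.
set a := (1 + k) / w; rewrite mulNr; set c := m / w.
(* With alpha = a - i c = 1 / (1 - h), the left-hand side is
   |2 alpha - 1|^2 = |(1 + h) / (1 - h)|^2. *)
have ac : (2 * a - 1) ^+ 2 + 4 * c ^+ 2 = 1 - 4 * (k / w).
  rewrite /a /c /w; field.
  by rewrite -/w gt_eqF.
have kw : 0 < k / w by rewrite divr_gt0.
have cE : m = c * w by rewrite /c divfK// gt_eqF.
have c0 : 0 < c by rewrite divr_gt0//; lra.
have c10 : A ^+ 2 * P <= 50 * c by nra.
have eP : 0 < e * P by rewrite mulr_gt0.
have main : e * P < 2 * c * A.
  have : A ^+ 2 * P * A <= 50 * c * A by rewrite ler_pM2r.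
  have : e * P * 40 = A ^+ 3 * P by rewrite /e; field.
  by rewrite exprSr; nra.
have Fle : e * P * ((2 * a - 1) ^+ 2 + 4 * c ^+ 2) <= e * P.
  by rewrite ler_piMr ?(ltW eP)// ac; lra.
rewrite [X in X < 0](_ : _ = e * P *
  (e * P * ((2 * a - 1) ^+ 2 + 4 * c ^+ 2) - 2 * c * A)); last by ring.
by rewrite pmulr_rlt0//; lra.
Qed.

End RealCoordinates.

(** * Distances in complex hyperbolic space *)

Section Arcosh.
Variable R : realType.
Implicit Types a b c : R.

Lemma arcosh_add a b : 1 <= a -> 1 <= b ->
  arcosh a + arcosh b =
  arcosh (a * b + Num.sqrt ((a ^+ 2 - 1) * (b ^+ 2 - 1))).
Proof.
move=> a1 b1.
have sq1 (x : R) : 1 <= x -> 0 <= x ^+ 2 - 1.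
  by move=> x1; rewrite subr_ge0 expr_ge1//; apply: le_trans x1.
have [a2 b2] := (sq1 _ a1, sq1 _ b1).
pose sa := Num.sqrt (a ^+ 2 - 1); pose sb := Num.sqrt (b ^+ 2 - 1).
have saE : sa ^+ 2 = a ^+ 2 - 1 by rewrite sqr_sqrtr.
have sbE : sb ^+ 2 = b ^+ 2 - 1 by rewrite sqr_sqrtr.
have sa0 : 0 <= sa by rewrite sqrtr_ge0.
have sb0 : 0 <= sb by rewrite sqrtr_ge0.
have h1 : (a * b + sa * sb) ^+ 2 - 1 = (a * sb + b * sa) ^+ 2.
  transitivity ((a * sb + b * sa) ^+ 2 + ((a ^+ 2 - sa ^+ 2) * (b ^+ 2 - sb ^+ 2) - 1)).
    by ring.
  by rewrite saE sbE; ring.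
have h2 : 0 <= a * sb + b * sa by rewrite addr_ge0// mulr_ge0//; lra.
rewrite /arcosh (sqrtrM _ a2) -/sa -/sb h1 sqrtr_sqr ger0_norm//.
rewrite -lnM ?posrE; [congr ln; ring|lra|lra].
Qed.

Lemma arcosh_ge_ln a : 0 < a -> ln a <= arcosh a.
Proof.
by move=> a0; rewrite ler_ln ?posrE ?lerDl ?sqrtr_ge0// ltr_wpDr ?sqrtr_ge0.
Qed.

Lemma arcosh_le_ln a : 0 < a -> arcosh a <= ln (2 * a).
Proof.
move=> a0.
have h : Num.sqrt (a ^+ 2 - 1) <= a.
  rewrite -[leRHS]ger0_norm ?(ltW a0)// -sqrtr_sqr ler_wsqrtr//; lra.
by rewrite ler_ln ?posrE ?ltr_wpDr ?sqrtr_ge0 ?mulr_gt0//; lra.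
Qed.

Lemma le_arcosh a b : 0 < a -> a <= b -> arcosh a <= arcosh b.
Proof.
move=> a0 ab; have b0 : 0 < b by exact: lt_le_trans ab.
rewrite ler_ln ?posrE ?ltr_wpDr ?sqrtr_ge0// lerD// ler_wsqrtr// lerB//.
by rewrite lerXn2r// nnegrE ltW.
Qed.

End Arcosh.

Section Embedding.
Variable R : realType.
Local Notation C2 := (C2 R).
Implicit Types p q : C2.

Lemma chyp_distE n (x y : chyp R n) (u v A B : R) :
    herm (val x) (val y) = (u +i* v)%C ->
    herm (val x) (val x) = (- A)%:C%C -> herm (val y) (val y) = (- B)%:C%C ->
    0 <= A * B ->
  chyp_dist x y = arcosh (Num.sqrt ((u ^+ 2 + v ^+ 2) / (A * B))).
Proof.
move=> hxy hx hy AB; rewrite /chyp_dist hxy hx hy normc_def /=.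
have uv0 : 0 <= u ^+ 2 + v ^+ 2 by rewrite addr_ge0 ?sqr_ge0.
by rewrite mulr0 subr0 mulrNN (sqrtrM _ uv0) sqrtrV //.
Qed.

Lemma mulcJ (a b c e : R) :
  (a +i* b)%C * ((c +i* e)%C)^* = ((a * c + b * e) +i* (b * c - a * e))%C.
Proof. by congr Complex => /=; ring. Qed.

Variable n : nat.

Definition coords p : 'rV[R[i]]_n.+2 :=
  \row_k (if val k == 0%N then (p.1.1 +i* p.1.2)%C
          else if val k == 1%N then (p.2.1 +i* p.2.2)%C else 0).

Lemma herm_coords p q : herm (coords p) (coords q) = (hre p q +i* him p q)%C.
Proof.
rewrite /herm !big_ord_recl big1 => [|k _]; last by rewrite !mxE mul0r.
rewrite !mxE /= !mulcJ addr0; apply/eqP; rewrite eq_complex /=.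
by rewrite /hre /him; apply/andP; split; apply/eqP; ring.
Qed.

Lemma herm_coords_self p : herm (coords p) (coords p) = (- (1 - sqn p))%:C%C.
Proof. by rewrite herm_coords hre_self him_self. Qed.

Lemma coords_neg p : (herm (coords p) (coords p) < 0) = (sqn p < 1).
Proof. by rewrite herm_coords_self ltcE /= eqxx /= oppr_lt0 subr_gt0. Qed.

Let origin_neg : herm (coords (0, 0, (0, 0))) (coords (0, 0, (0, 0))) < 0.
Proof. by rewrite coords_neg /sqn /= expr0n /= !addr0. Qed.

Definition origin : chyp R n.+2 := exist _ (coords (0, 0, (0, 0))) origin_neg.

(** Made total by a junk value outside the ball, so that a subset of complex
  hyperbolic space can be pulled back to the whole of C^2. *)
Definition emb p : chyp R n.+2 := insubd origin (coords p).

Lemma val_emb p : sqn p < 1 -> val (emb p) = coords p.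
Proof. by move=> p1; rewrite insubdK // -topredE /= coords_neg. Qed.

Lemma herm_emb p q : sqn p < 1 -> sqn q < 1 ->
  herm (val (emb p)) (val (emb q)) = (hre p q +i* him p q)%C.
Proof. by move=> p1 q1; rewrite !val_emb// herm_coords. Qed.

Lemma herm_emb_self p : sqn p < 1 ->
  herm (val (emb p)) (val (emb p)) = (- (1 - sqn p))%:C%C.
Proof. by move=> p1; rewrite !val_emb// herm_coords_self. Qed.

Lemma chyp_dist_emb p q : sqn p < 1 -> sqn q < 1 ->
  chyp_dist (emb p) (emb q) =
  arcosh (Num.sqrt (hsq p q / ((1 - sqn p) * (1 - sqn q)))).
Proof.
move=> p1 q1; apply: chyp_distE.
- exact: herm_emb.
- exact: herm_emb_self.
- exact: herm_emb_self.
- by rewrite mulr_ge0// subr_ge0 ltW.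
Qed.

Lemma chyp_distC m (x y : chyp R m) : chyp_dist x y = chyp_dist y x.
Proof.
rewrite /chyp_dist; have -> : herm (val y) (val x) = (herm (val x) (val y))^*.
  rewrite /herm rmorphB rmorph1 rmorph_sum /=; congr (_ - _).
  by apply: eq_bigr => k _; rewrite rmorphM /= conjCK mulrC.
by rewrite norm_conjC [X in Num.sqrt (complex.Re X)]mulrC.
Qed.

(** With d = p - q, the difference of the two sides is
  |<d, q>|^2 + (1 - |q|^2) |d|^2. *)
Lemma reverse_cauchy_schwarz p q : sqn p < 1 -> sqn q < 1 ->
  (1 - sqn p) * (1 - sqn q) <= hsq p q.
Proof.
move=> p1 q1.
pose d : C2 := ((p.1.1 - q.1.1, p.1.2 - q.1.2), (p.2.1 - q.2.1, p.2.2 - q.2.2)).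
rewrite -subr_ge0.
have -> : hsq p q - (1 - sqn p) * (1 - sqn q) =
    (hre d q + 1) ^+ 2 + him d q ^+ 2 + (1 - sqn q) * sqn d.
  by case: p q p1 q1 @d => [[? ?] [? ?]] [[? ?] [? ?]] p1 q1;
    rewrite /hsq /hre /him /sqn /=; ring.
by rewrite !addr_ge0 ?sqr_ge0// mulr_ge0 ?sqn_ge0// subr_ge0 ltW.
Qed.

(** With A = 1 - |p|^2, B = 1 - |q|^2 and h the squared modulus of <p, q> - 1, the
  squares of the three hyperbolic cosines are rational in A, B, h and t.  Both
  terms of the addition formula are rational multiples of the cosine of the whole
  distance, and the multiples add up to 1. *)
Lemma between_geodesic p q t : sqn p < 1 -> sqn q < 1 -> 0 <= t ->
  between (@chyp_dist R n.+2) (emb p) (emb (geodesic p q t)) (emb q).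
Proof.
move=> p1 q1 t0; have r1 := sqn_geodesic_lt1 t0 p1 q1.
rewrite /between [X in X + _]chyp_distC !chyp_dist_emb//.
have w0 := weight_gt0 t0 p1 q1; have wN := lt0r_neq0 w0.
have N := sqn_geodesic wN; have rcs := reverse_cauchy_schwarz p1 q1.
have hp : hsq (geodesic p q t) p * weight t p q = (1 - sqn p + t * hsq p q) ^+ 2.
  rewrite /hsq hre_affine him_affine !hre_self !him_self (hreC q p) (himC q p).
  move: wN; rewrite /weight.
  by move: (hre p q) (him p q) (sqn p) => u v k wN; field.
have hq : hsq (geodesic p q t) q * weight t p q =
    hsq p q * (1 + t * (1 - sqn q)) ^+ 2.
  rewrite /hsq hre_affine him_affine !hre_self !him_self.
  move: wN; rewrite /weight.
  by move: (hre p q) (him p q) (sqn q) => u v k wN; field.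
set r := geodesic p q t in r1 N hp hq *.
have A0 : 0 < 1 - sqn p by rewrite subr_gt0.
have B0 : 0 < 1 - sqn q by rewrite subr_gt0.
have C0 : 0 < 1 - sqn r by rewrite subr_gt0.
move: A0 B0 C0 w0 wN N rcs hp hq (hsq_ge0 p q).
move: (1 - sqn p) (1 - sqn q) (1 - sqn r) (weight t p q).
move: (hsq p q) (hsq r p) (hsq r q) => h k l A B C w.
move=> A0 B0 C0 w0 wN N rcs hp hq h0.
set a := Num.sqrt (k / _); set b := Num.sqrt (l / _); set c := Num.sqrt _.
have th : 0 <= t * h by rewrite mulr_ge0.
have [AN BN CN] : [/\ A != 0, B != 0 & C != 0] by rewrite !gt_eqF.
pose D := A + 2 * t * h + t ^+ 2 * h * B.
have D0 : 0 < D by rewrite /D -N mulr_gt0.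
have CE : C = D / w by rewrite /D -N mulfK.
have kE : k = (A + t * h) ^+ 2 / w by rewrite -hp mulfK.
have lE : l = h * (1 + t * B) ^+ 2 / w by rewrite -hq mulfK.
have DN : D != 0 by rewrite gt_eqF.
have hAB : 0 <= h - A * B by rewrite subr_ge0.
have scale (x u y : R) : 0 <= x -> u = x ^+ 2 * (h / (A * B)) -> y = u ->
    Num.sqrt y = x * c.
  by move=> x0 -> ->; rewrite sqrtrM ?sqr_ge0// sqrtr_sqr ger0_norm.
have tB : 0 <= 1 + t * B by rewrite addr_ge0// mulr_ge0// ltW.
have a0 : 0 <= k / (C * A).
  apply: divr_ge0; last by rewrite mulr_ge0 ?ltW.
  by rewrite kE; apply: divr_ge0; rewrite ?sqr_ge0 ?ltW.
have b0 : 0 <= l / (C * B).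
  apply: divr_ge0; last by rewrite mulr_ge0 ?ltW.
  by rewrite lE; apply: divr_ge0; rewrite ?(ltW w0)// mulr_ge0 ?sqr_ge0.
have aE : a ^+ 2 = 1 + t ^+ 2 * h * (h - A * B) / (A * D).
  rewrite sqr_sqrtr// kE CE; move: DN; rewrite /D => DN.
  by field; rewrite wN AN DN.
have bE : b ^+ 2 = 1 + (h - A * B) / (B * D).
  rewrite sqr_sqrtr// lE CE; move: DN; rewrite /D => DN.
  by field; rewrite wN BN DN.
have ge1 (x : R) : 0 <= x -> 1 <= x ^+ 2 -> 1 <= x.
  by move=> x0 x2; rewrite -(@ler_pXn2r _ 2) ?nnegrE ?expr1n.
have a1 : 1 <= a.
  apply: ge1; rewrite ?sqrtr_ge0// aE lerDl.
  apply: divr_ge0; last by rewrite mulr_ge0 ?ltW.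
  by apply: mulr_ge0 => //; rewrite mulr_ge0 ?sqr_ge0.
have b1 : 1 <= b.
  apply: ge1; rewrite ?sqrtr_ge0// bE lerDl.
  by apply: divr_ge0 hAB _; apply: mulr_ge0; apply: ltW.
rewrite arcosh_add//; congr arcosh.
have -> : a * b = (A + t * h) * (1 + t * B) / D * c.
  rewrite -sqrtrM//; apply: scale (erefl _) _.
    apply: divr_ge0; last exact: ltW.
    by apply: mulr_ge0 => //; rewrite addr_ge0 ?(ltW A0).
  rewrite kE lE CE; move: DN; rewrite /D => DN.
  by field; rewrite wN AN BN DN.
have -> : Num.sqrt ((a ^+ 2 - 1) * (b ^+ 2 - 1)) = t * (h - A * B) / D * c.
  apply: scale (erefl _) _.
    by apply: divr_ge0; [exact: mulr_ge0 | exact: ltW].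
  rewrite aE bE; move: DN; rewrite /D => DN.
  by field; rewrite AN BN DN.
rewrite -mulrDl -[RHS]mul1r; congr (_ * _).
by move: DN; rewrite /D => DN; field.
Qed.
End Embedding.

(** * Embeddings into median spaces *)

Section Conclusion.
Variables (R : realType) (n : nat).
Local Notation C2 := (C2 R).
Local Notation X := (chyp R n.+2).
Local Notation dist := (@chyp_dist R n.+2).
Local Notation emb := (@emb R n).

Definition axis_point (r : R) : C2 := ((r, 0), (0, 0)).

Lemma sqn_axis_point r : sqn (axis_point r) = r ^+ 2.
Proof. by rewrite /sqn /= expr0n /= !addr0. Qed.

(** The Euclidean norm of the points at hyperbolic distance arcosh c from the
  center. *)
Definition radius (c : R) : R := Num.sqrt (1 - c ^- 2).

Lemma sqr_radius c : 1 <= c -> 1 - radius c ^+ 2 = c ^- 2.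
Proof.
move=> c1; rewrite sqr_sqrtr; first by ring.
by rewrite subr_ge0 invf_le1 ?expr_ge1 ?exprn_gt0//; lra.
Qed.

Lemma radius_lt1 c : 1 <= c -> radius c ^+ 2 < 1.
Proof.
move=> c1; rewrite -subr_gt0 sqr_radius// invr_gt0 exprn_gt0//; lra.
Qed.

Lemma dist_radius c r : 1 <= c -> r ^+ 2 = radius c ^+ 2 ->
  dist (emb (axis_point 0)) (emb (axis_point r)) = arcosh c.
Proof.
move=> c1 rc; have r1 : sqn (axis_point r) < 1.
  by rewrite sqn_axis_point rc radius_lt1.
have o1 : sqn (axis_point 0) < 1 by rewrite sqn_axis_point expr0n.
rewrite chyp_dist_emb// !sqn_axis_point rc sqr_radius// expr0n subr0 mul1r invrK.
have -> : hsq (axis_point 0) (axis_point r) = 1.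
  by rewrite /hsq /hre /him /=; ring.
by rewrite mul1r sqrtr_sqr ger0_norm//; lra.
Qed.

Lemma arcosh_unbounded (D : R) : exists2 c : R, 1 <= c & D < arcosh c.
Proof.
exists (expR (`|D| + 1)); first by rewrite -expR0 ler_expR addr_ge0.
apply: lt_le_trans (arcosh_ge_ln (expR_gt0 _)).
by rewrite expRK; apply: le_lt_trans (ler_norm D) _; rewrite ltrDl.
Qed.

Lemma dist_unbounded (D : R) : exists2 p, sqn p < 1 &
  D < dist (emb (axis_point 0)) (emb p).
Proof.
have [c c1 Dc] := arcosh_unbounded D.
exists (axis_point (radius c)); first by rewrite sqn_axis_point radius_lt1.
by rewrite (dist_radius c1).
Qed.

Lemma chyp_not_in_pseudo_median (T : Type) (d : T -> T -> R) (f : X -> T) :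
  pseudo_median d -> ~ (forall x y, d (f x) (f y) = dist x y).
Proof.
move=> pm isof.
have [D|H [[cH cHC] Hs [y [p p1 <-] nHp]]] :=
    halfspace_through_finite (map emb (axis_points R)) (o := emb (axis_point 0))
      (Y := [set emb p | p in [set p | sqn p < 1]]) pm isof.
  by have [p p1 Dp] := dist_unbounded D; exists (emb p) => //; exists p.
apply: nHp; apply: (@convex_cut_trivial R [set p | H (emb p)]) p1.
- move=> q r t q1 r1 t0 /= Hq Hr.
  by apply: cH Hq Hr _; apply: between_geodesic.
- move=> q r t q1 r1 t0 /= Hq Hr.
  by apply: (cHC (emb q) (emb r)) => //; apply: between_geodesic.
- by move=> q qs; apply: Hs; exact: (List.in_map emb _ _ qs).
Qed.

Lemma herm_axis_point r (z : 'rV[R[i]]_n.+2) :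
  herm (coords n (axis_point r)) z =
  ((r * complex.Re (z ord0 ord0) - 1) +i* (- (r * complex.Im (z ord0 ord0))))%C.
Proof.
rewrite /herm !big_ord_recl big1 => [|k _]; last by rewrite !mxE mul0r.
rewrite !mxE /=; case: (z ord0 ord0) => x y; case: (z _ _) => x' y'.
rewrite !mulcJ addr0; apply/eqP; rewrite eq_complex /=.
by apply/andP; split; apply/eqP; ring.
Qed.

Lemma herm_self_le (p : X) : exists u : R,
  [/\ 0 < u, herm (val p) (val p) = (- u)%:C%C &
      u <= 1 - complex.Re (val p ord0 ord0) ^+ 2].
Proof.
have := valP p; rewrite ltcE /= => /andP[/eqP im0 re0].
exists (- complex.Re (herm (val p) (val p))); split.
- by rewrite oppr_gt0.
- by rewrite opprK; apply/eqP; rewrite eq_complex /= -im0 !eqxx.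
- have : 0 <= \sum_(k < n.+1) val p ord0 (lift ord0 k) * (val p ord0 (lift ord0 k))^*.
    by apply: sumr_ge0 => k _; rewrite mul_conjC_ge0.
  rewrite lecE /= => /andP[_ rest0].
  rewrite /herm big_ord_recl /=.
  move: rest0; case: (\sum_(i < n.+1) _) => a b /=.
  case: (val p ord0 ord0) => x y; rewrite mulcJ /= => a0.
  by have := sqr_ge0 y; lra.
Qed.

Lemma dist_axis_point r (p : X) (u : R) : 0 < u -> r ^+ 2 < 1 ->
    herm (val p) (val p) = (- u)%:C%C ->
  dist (emb (axis_point r)) p =
  arcosh (Num.sqrt (((1 - r * complex.Re (val p ord0 ord0)) ^+ 2 +
    (r * complex.Im (val p ord0 ord0)) ^+ 2) / ((1 - r ^+ 2) * u))).
Proof.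
move=> u0 r1 hp; have a1 : sqn (axis_point r) < 1 by rewrite sqn_axis_point.
have hr : herm (val (emb (axis_point r))) (val p) =
    ((r * complex.Re (val p ord0 ord0) - 1) +i*
     (- (r * complex.Im (val p ord0 ord0))))%C.
  by rewrite val_emb//; exact: herm_axis_point.
rewrite (chyp_distE hr (herm_emb_self _ a1) hp); last first.
  by rewrite mulr_ge0 ?subr_ge0 ?ltW.
by rewrite sqn_axis_point; congr (arcosh (Num.sqrt (_ / _))); ring.
Qed.

(** The sign s is chosen so that s Re p1 <= 0, where p1 is the first coordinate of
  p.  Then cosh dist(s r, p) >= cosh dist(0, s r) cosh dist(0, p).  The other
  estimate is a triangle inequality up to a constant: |1 + s r p1| is at least
  (1 - |p|^2) / 2, that is 1 / (2 cosh^2 dist(0, p)). *)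
Lemma axis_point_estimates (c : R) (p : X) : 1 <= c ->
  exists s, [/\ s = 1 \/ s = - 1, 0 <= dist (emb (axis_point 0)) p,
    arcosh c <= dist (emb (axis_point (s * radius c))) p &
    arcosh c - dist (emb (axis_point 0)) p - 2 * ln 2 <=
      dist (emb (axis_point (- (s * radius c)))) p].
Proof.
move=> c1; have [u [u0 hp ule]] := herm_self_le p.
have c0 : 0 < c by lra.
have c20 : 0 < c ^- 2 by rewrite invr_gt0 exprn_gt0.
have cV : (c ^- 2)^-1 = c ^+ 2 by rewrite invrK.
have [s [sE sx]] : exists s : R,
    [/\ s = 1 \/ s = - 1 & s * complex.Re (val p ord0 ord0) <= 0].
  have [x0|/ltW x0] := leP (complex.Re (val p ord0 ord0)) 0.
    by exists 1; split; [left|rewrite mul1r].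
  by exists (-1); split; [right|rewrite mulN1r oppr_le0].
have s2 : s ^+ 2 = 1 by case: sE => ->; rewrite ?sqrrN expr1n.
set x := complex.Re (val p ord0 ord0) in ule sx.
set y := complex.Im (val p ord0 ord0).
(* a is cosh dist(0, p). *)
pose a := Num.sqrt u^-1.
have a2 : a ^+ 2 = u^-1 by rewrite sqr_sqrtr// invr_ge0 ltW.
have a0 : 0 < a by rewrite sqrtr_gt0 invr_gt0.
have a1 : 1 <= a.
  rewrite -(@ler_pXn2r _ 2) ?nnegrE ?(ltW a0)// expr1n a2 invf_ge1//.
  by have := sqr_ge0 x; lra.
have r0 : 0 <= radius c by rewrite sqrtr_ge0.
have r1 : radius c <= 1.
  by rewrite -(@ler_pXn2r _ 2) ?nnegrE// expr1n ltW// radius_lt1.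
have lower (w v : R) : 0 <= w ->
    w * c * a <= Num.sqrt ((w ^+ 2 + v ^+ 2) / (c ^- 2 * u)).
  move=> w0; have wca : 0 <= w * c * a by rewrite !mulr_ge0// ltW.
  rewrite -[leLHS]ger0_norm// -sqrtr_sqr ler_wsqrtr// 2!exprMn a2.
  rewrite invfM cV -mulrA ler_wpM2r ?lerDl ?sqr_ge0//.
  by rewrite mulr_ge0 ?sqr_ge0// invr_ge0 ltW.
have dist_s t : t ^+ 2 = 1 -> dist (emb (axis_point (t * radius c))) p =
    arcosh (Num.sqrt (((1 - t * radius c * x) ^+ 2 +
      (t * radius c * y) ^+ 2) / (c ^- 2 * u))).
  move=> t2; have h : (t * radius c) ^+ 2 = radius c ^+ 2.
    by rewrite exprMn t2 mul1r.
  by rewrite (dist_axis_point u0 _ hp) h ?sqr_radius// radius_lt1.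
have d0 : dist (emb (axis_point 0)) p = arcosh a.
  rewrite (dist_axis_point u0 _ hp) ?expr0n//=.
  by rewrite !mul0r !subr0 expr1n expr0n addr0 mul1r mul1r.
have srx : s * x <= s * radius c * x <= 0.
  rewrite mulrAC mulr_le0_ge0// andbT.
  by move: sx; move: (s * x) => z z0; nra.
exists s; split=> //.
- by rewrite d0; apply: le_trans (arcosh_ge_ln a0); exact: ln_ge0.
- rewrite dist_s//; apply: le_arcosh => //.
  have w1 : 1 <= 1 - s * radius c * x by move/andP: srx => [? ?]; lra.
  apply: le_trans (lower _ _ _); last by lra.
  rewrite -mulrA; apply: le_trans (_ : c * a <= _).
    by apply: ler_peMr => //; exact: ltW.
  by apply: ler_peMl => //; apply: mulr_ge0; exact: ltW.
rewrite d0 -[- (s * _)]mulNr dist_s ?sqrrN//.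
have sx1 : - 1 <= s * x.
  have : (s * x) ^+ 2 <= 1 by rewrite exprMn s2 mul1r; lra.
  by move: (s * x) => z; nra.
have uw : u / 2 <= 1 - - s * radius c * x.
  have : u <= 1 - (s * x) ^+ 2 by rewrite exprMn s2 mul1r.
  by rewrite !mulNr opprK; move/andP: srx => [? ?]; nra.
have w0 : 0 <= 1 - - s * radius c * x by lra.
have v0 : 0 < c / (2 * a) by rewrite divr_gt0// mulr_gt0.
have le1 : c / (2 * a) <= (1 - - s * radius c * x) * c * a.
  have -> : c / (2 * a) = u / 2 * c * a.
    by rewrite -[u]invrK -a2; field; rewrite gt_eqF.
  by rewrite !ler_wpM2r// ltW.
have := arcosh_ge_ln (lt_le_trans v0 (le_trans le1 (lower _ (- s * radius c * y) w0))).
have := le_trans le1 (lower _ (- s * radius c * y) w0).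
move=> /(le_arcosh v0); have := arcosh_ge_ln v0.
have := arcosh_le_ln c0; have := arcosh_ge_ln a0.
rewrite ln_div ?posrE ?mulr_gt0// !lnM ?posrE//; lra.
Qed.

Lemma dist_opposite c : 1 <= c ->
  dist (emb (axis_point (radius c))) (emb (axis_point (- radius c))) =
  2 * arcosh c.
Proof.
move=> c1; have c0 : 0 < c by lra.
have r1 := radius_lt1 c1; have r2 := sqr_radius c1.
rewrite chyp_dist_emb !sqn_axis_point ?sqrrN// r2.
rewrite [RHS]mulrDl !mul1r arcosh_add//; congr arcosh.
have c21 : 1 <= c ^+ 2 by rewrite expr_ge1// ltW.
have -> : hsq (axis_point (radius c)) (axis_point (- radius c)) =
    (2 - c ^- 2) ^+ 2.
  by rewrite -r2 /hsq /hre /him /=; ring.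
have -> : (2 - c ^- 2) ^+ 2 / (c ^- 2 * c ^- 2) = (2 * c ^+ 2 - 1) ^+ 2.
  by field; rewrite gt_eqF.
by rewrite !sqrtr_sqr !ger0_norm; [ring|lra|lra].
Qed.

(** The first power inequality bounds u, so s is at least b rho for large rho, where
  b = 2^alpha / 2 < 1.  Then t^alpha + s^alpha is at least (1 + b) rho^alpha,
  which exceeds (2 rho)^alpha = 2 b rho^alpha by an unbounded amount. *)
Lemma power_gap (alpha C k : R) : 0 < alpha < 1 -> 0 <= C ->
  exists D, forall rho t s u : R, D < rho -> 0 <= u -> rho <= t ->
    rho - u - k <= s ->
    u `^ alpha + t `^ alpha <= rho `^ alpha + C ->
  (2 * rho) `^ alpha + C < t `^ alpha + s `^ alpha.
Proof.
move=> /andP[al0 al1] C0.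
pose b := 2 `^ alpha / 2.
have b2 : 2 `^ alpha = 2 * b by rewrite /b mulrC divfK.
have b0 : 0 < b by rewrite divr_gt0// powR_gt0.
have b1 : b < 1.
  rewrite ltr_pdivrMr// mul1r -[ltRHS]powRr1//.
  by rewrite /powR gt_eqF// ltr_expR ltr_pM2r// ln_gt0; lra.
have bal : b <= b `^ alpha by apply: ger1_powR; [rewrite b0 ltW | exact: ltW].
have b1' : 0 < 1 - b by rewrite subr_gt0.
pose U := C `^ alpha^-1.
pose K := (U + k) / (1 - b).
pose L := (C / (1 - b)) `^ alpha^-1.
have root x y : 0 <= x -> 0 <= y -> x `^ alpha <= y -> x <= y `^ alpha^-1.
  move=> x0 y0 xy; rewrite -[leLHS]powRr1// -[X in x `^ X](mulfV (lt0r_neq0 al0)).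
  rewrite powRrM; apply: ge0_ler_powR => //; rewrite ?nnegrE ?powR_ge0//.
  by rewrite invr_ge0 ltW.
have mono x y : 0 <= x -> x <= y -> x `^ alpha <= y `^ alpha.
  move=> x0 xy; apply: ge0_ler_powR; rewrite ?nnegrE ?(ltW al0)//.
  exact: le_trans xy.
exists (Num.max K L) => rho t s u; rewrite gt_max => /andP[Kc Lc] u0 t_ge s_ge.
move=> ut; rewrite ltNge; apply/negP => ts.
have L0 : 0 <= L by exact: powR_ge0.
have rho0 : 0 < rho by exact: le_lt_trans L0 Lc.
have Kc' : b * rho <= rho - U - k.
  by move: Kc; rewrite /K ltr_pdivrMr//; lra.
have Lc' : C < (1 - b) * rho `^ alpha.
  rewrite [ltRHS]mulrC -ltr_pdivrMr//.
  have D0 : 0 <= C / (1 - b) by apply: divr_ge0 => //; exact: ltW.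
  have /(gt0_ltr_powR al0) : L < rho by [].
  rewrite !nnegrE => /(_ L0 (ltW rho0)); rewrite /L -powRrM (mulVf (lt0r_neq0 al0)).
  by rewrite (powRr1 D0).
have tal := mono _ _ (ltW rho0) t_ge.
have ual : u `^ alpha <= C by lra.
have uU : u <= U := root _ _ u0 C0 ual.
have sal : b * rho `^ alpha <= s `^ alpha.
  have brho : 0 <= b * rho := mulr_ge0 (ltW b0) (ltW rho0).
  have brs : b * rho <= s by lra.
  apply: le_trans (mono _ _ brho brs).
  by rewrite (powRM _ (ltW b0) (ltW rho0)) ler_wpM2r// powR_ge0.
by move: ts; rewrite (powRM _ (ler0n _ 2) (ltW rho0)) b2; lra.
Qed.

(** The point p whose image is C-close to the median of the images of 0 and of two
  opposite points is almost between each two of them for dist^alpha. *)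
Lemma snowflake_not_near_median (alpha : R) (M : metricType R) (f : X -> M) :
    0 < alpha < 1 -> median_space M ->
    isometric_embedding (fun x y => dist x y `^ alpha) f ->
  ~ bounded_hausdorff (range f) [set: M].
Proof.
move=> al med isof [C [_ HC]].
have C0 : 0 <= 2 * C.
  rewrite mulr_ge0//; have [a _] := HC (f (emb (axis_point 0))) I.
  by apply: le_trans (mdist_ge0 _ _).
have [D gap] := power_gap (2 * ln 2) al C0.
have [c c1 Dc] := arcosh_unbounded D.
pose pt (s : R) := emb (axis_point (s * radius c)).
have [m [[m1 m2 m3] _]] := med (f (pt 0)) (f (pt 1)) (f (pt (-1))).
have [_ [p _ <-] mp] := HC m I.
have key x y : mdist (f x) m + mdist m (f y) = mdist (f x) (f y) ->
    dist x p `^ alpha + dist y p `^ alpha <= dist x y `^ alpha + 2 * C.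
  rewrite -!isof => <-.
  have := metric_triangle (f x) m (f p); have := metric_triangle (f y) m (f p).
  by rewrite [mdist (f y) m]metric_sym; lra.
have [s [sE u0 t_ge s_ge]] := axis_point_estimates p c1.
have pt0 : pt 0 = emb (axis_point 0) by rewrite /pt mul0r.
have d0s : dist (pt 0) (pt s) = arcosh c.
  rewrite pt0 /pt (dist_radius c1)// exprMn.
  by case: sE => ->; rewrite ?sqrrN expr1n mul1r.
have dss : dist (pt s) (pt (- s)) = 2 * arcosh c.
  case: sE => ->; rewrite /pt ?opprK mul1r mulN1r; first exact: dist_opposite.
  by rewrite chyp_distC; exact: dist_opposite.
have [k0 ks] : mdist (f (pt 0)) m + mdist m (f (pt s)) =
      mdist (f (pt 0)) (f (pt s)) /\
    mdist (f (pt s)) m + mdist m (f (pt (- s))) =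
      mdist (f (pt s)) (f (pt (- s))).
  case: sE => ->; first by [].
  rewrite opprK; split=> //.
  by rewrite [RHS]metric_sym -m2 addrC (metric_sym m (f (pt 1)))
    (metric_sym m (f (pt (-1)))).
rewrite -[- (s * _)]mulNr -/(pt s) -/(pt (- s)) -pt0 in u0 t_ge s_ge.
have h0 := key _ _ k0; have hs := key _ _ ks; rewrite d0s in h0; rewrite dss in hs.
by have := lt_le_trans (gap _ _ _ _ Dc u0 t_ge s_ge h0) hs; rewrite ltxx.
Qed.

End Conclusion.

Theorem corollary1p6 (R : realType) (n : nat) (hn : (2 <= n)%N) :
  ((~ exists (M : metricType R) (f : chyp R n -> M),
        median_space M /\ isometric_embedding (@chyp_dist R n) f) /\
   ~ wall_metric (@chyp_dist R n)) /\
  (forall alpha : R, 2^-1 <= alpha -> alpha < 1 ->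
     wall_metric (fun x y : chyp R n => chyp_dist x y `^ alpha) ->
     ~ exists (M : metricType R) (f : chyp R n -> M),
         [/\ median_space M,
             isometric_embedding (fun x y => chyp_dist x y `^ alpha) f &
             bounded_hausdorff (range f) [set: M]]).
Proof.
case: n hn => [//|[//|k _]]; split; first split.
- move=> [M [f [med isof]]].
  exact: chyp_not_in_pseudo_median (median_space_pseudo_median med) isof.
- move=> wall.
  have [T [d [f [pm isof]]]] :=
    wall_metric_pseudo_median (emb k (axis_point 0)) wall.
  exact: chyp_not_in_pseudo_median pm isof.
- move=> alpha al2 al1 _ [M [f [med isof]]].
  apply: snowflake_not_near_median med isof.
  by rewrite al1 andbT (lt_le_trans _ al2)// invr_gt0.
Qed.
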